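(* Let $(X,d,\nu)$ be a computable metric space which is $\delta_{\text{disj-cover}}'$-computable (as an element of $\mathcal{Z}_{\mathrm{c}}(X)$). Then the operation $$E:\subseteq\mathcal{A}(X)\rightrightarrows C(X,X),\quad A\mapsto\{f : \operatorname{im}f=A\wedge f|_A=\mathrm{id}_A\},\qquad\operatorname{dom}E=\mathcal{A}(X)\setminus\{\emptyset\},$$ is well-defined (i.e. $E(A)\neq\emptyset$ for every nonempty closed $A\subseteq X$) and computable, where the class $\mathcal{A}(X)$ of closed subsets of $X$ is represented by $\delta_{\text{range}}\sqcap\delta_{\text{dist}}^{>}$ and $C(X,X)$ by $[\delta_X\to\delta_X]$.
   Context: TTE conventions. $\mathbb{B}=\mathbb{N}^{\mathbb{N}}$, $p_i:=p(i)$. $\langle\cdot\rangle:\mathbb{N}^*\to\mathbb{N}$ (words) and $\langle\cdot,\cdot\rangle:\mathbb{N}^2\to\mathbb{N}$ (pairs) are standard computable tupling bijections, with projections $\pi_1,\pi_2:\mathbb{N}\to\mathbb{N}$ for pairs. On $\mathbb{B}$: $\langle p^{(0)},p^{(1)}\rangle(2i+z)=p^{(z)}_i$ ($z\in\{0,1\}$) and $\langle p^{(0)},p^{(1)},\dots\rangle(\langle i,j\rangle)=p^{(i)}_j$. A representation of a set is a partial surjection $\delta:\subseteq\mathbb{B}\to X$; a point is $\delta$-computable if it has a computable $\delta$-name. A multi-valued operation $f:\subseteq X\rightrightarrows Y$ assigns to each $x\in\operatorname{dom}f$ a subset $f(x)\subseteq Y$; a $(\delta,\delta')$-realiser of $f$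 is $F:\subseteq\mathbb{B}\to\mathbb{B}$ such that whenever $p\in\operatorname{dom}\delta$ and $\delta(p)\in\operatorname{dom}f$, $F(p)$ is defined, $F(p)\in\operatorname{dom}\delta'$ and $\delta'(F(p))\in f(\delta(p))$; $f$ is computable if it has a (Type-2 Turing machine) computable realiser. $\delta\sqcap\delta'$: $\langle p,q\rangle$ is a name of $x$ iff $\delta(p)=x=\delta'(q)$. $\eta$ is a standard representation (satisfying utm and smn theorems) of the continuous partial functions $\subseteq\mathbb{B}\to\mathbb{B}$ with $G_\delta$ domain, $\eta_p=\eta(p)$; $[\delta\to\delta']$: $p$ is a name of $f$ iff $\eta_p$ is a $(\delta,\delta')$-realiser of the total map $f$. Computable metric space $(X,d,\nu)$: $(X,d)$ is a metric space, $\nu:\mathbb{N}\to X$ is total with dense image, and $(i,j)\mapsto d(\nu(i),\nu(j))$ is a computable double sequence of reals. Cauchy representation $\delta_X$: $p$ is a name of $x$ iff $\lim_i\nu(p_i)=x$ and $d(\nu(p_i),\nu(p_j))<2^{-\min\{i,j\}}$ for all $i,j$. With $\nu_{\mathbb{Q}^+}$ a standard total numbering of the positive rationals, $\alpha\langle a,r\rangle=B_d(\nu(a);\nu_{\mathbb{Q}^+}(r))$. $\delta_{\text{range}}$: $\langle p^{(0)},p^{(1)},\dots\rangle$ is a name of closed $A$ iff either $A=\emptyset$ and $p^{(i)}=0^{\omega}$ for all $i$, or $A\neq\emptyset$, all entries of all $p^{(i)}$ are $\geq1$, and, with $P(p)_i:=p_i-1$, each $P(p^{(i)})$ is a $\delta_X$-name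 of a point of $A$ and the points $\delta_X(P(p^{(i)}))$, $i\in\mathbb{N}$, are dense in $A$. $\delta_{\text{dist}}^{>}$: $p$ is a name of closed $A$ iff $\eta_p$ is a $(\delta_X,\overline{\rho_{<}})$-realiser of $d_A:X\to\overline{\mathbb{R}}$, $d_A(x)=\inf_{a\in A}d(x,a)$ ($\inf\emptyset=\infty$), where $p$ is a $\overline{\rho_{<}}$-name of $t\in\overline{\mathbb{R}}$ iff $\{n\in\mathbb{N} : \nu_{\mathbb{Q}}(n)<t\}=\{p_i-1 : i\in\mathbb{N},p_i\geq1\}$, $\nu_{\mathbb{Q}}$ a standard numbering of $\mathbb{Q}$. For $w\in\mathbb{N}^*$, $U\langle w\rangle:=\bigcup_{i<|w|}\alpha(w_i)$. Words $u,v\in\mathbb{N}^*$ are formally disjoint if $d(\nu(\pi_1u_i),\nu(\pi_1v_j))>\nu_{\mathbb{Q}^+}(\pi_2u_i)+\nu_{\mathbb{Q}^+}(\pi_2v_j)$ for all $i<|u|,j<|v|$. $\delta_{\text{disj-cover}}'$ is the representation of $\mathcal{Z}_{\mathrm{c}}(X)=\{K\subseteq X\text{ compact} : \dim K\leq0\}$ ($\dim$ = covering dimension; i.e. $K$ is zero-dimensional or empty) for which $p$ is a name of $K$ iff $\{a\in\mathbb{N} : (\exists i)\,p_i=a+1\}$ equals the set of all $\langle\langle w^{(0)}\rangle,\dots,\langle w^{(l-1)}\rangle\rangle$ (word coding applied to the word of codes) with $l\in\mathbb{N}$, $w^{(0)},\dots,w^{(l-1)}\in\mathbb{N}^*$ pairwise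 formally disjoint and $\bigcup_{i<l}U\langle w^{(i)}\rangle\supseteq K$. In particular the hypothesis includes that $X$ is compact with $\dim X\leq0$. *)

(* Defs.v *)
From Stdlib Require Cantor.
From HB Require Import structures.
From mathcomp Require Import all_boot all_order all_algebra.
From mathcomp Require Import all_classical all_reals.
From mathcomp Require Import ereal topology.

Set Implicit Arguments.
Unset Strict Implicit.
Unset Printing Implicit Defensive.

Import Order.TTheory GRing.Theory Num.Theory.

Local Open Scope classical_set_scope.
Local Open Scope nat_scope.

(** * Codings *)

Notation baire := (nat -> nat).

Definition npair (i j : nat) : nat := Cantor.to_nat (i, j).
Definition proj1n (n : nat) : nat := (Cantor.of_nat n).1.
Definition proj2n (n : nat) : nat := (Cantor.of_nat n).2.

(* [CodeSeq.code] is a bijection, with inverse [CodeSeq.decode]. *)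
Definition wcode (w : seq nat) : nat := CodeSeq.code w.

(* Components of a name under the binary and the countable tupling of Baire
   space; both tuplings are bijective. *)
Definition bfst (p : baire) : baire := fun i => p i.*2.
Definition bsnd (p : baire) : baire := fun i => p i.*2.+1.
Definition bnth (p : baire) (i : nat) : baire := fun j => p (npair i j).

Definition nuQ (n : nat) : rat :=
  (((proj1n (proj1n n))%:R - (proj2n (proj1n n))%:R) / (proj2n n).+1%:R)%R.
Definition nuQpos (n : nat) : rat := ((proj1n n).+1%:R / (proj2n n).+1%:R)%R.

(** * Computability *)

(* Partial recursive functions relative to an oracle, as unary functions on
   nat with arguments packed by [npair]. *)
Inductive prog : Type :=
| PZero
| PSucc
| PFst
| PSnd
| POracle
| PPair of prog & prog
| PComp of prog & prog
| PRec of prog & prog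
| PMin of prog.

Fixpoint rec_rel (base : nat -> Prop) (step : nat -> nat -> Prop) (a n : nat) :
    nat -> Prop :=
  match n with
  | 0 => base
  | m.+1 => fun b =>
      exists2 c, rec_rel base step a m c & step (npair a (npair m c)) b
  end.

(* [run o e a b]: program [e] with oracle [o] halts on input [a] with value
   [b]; for fixed [o] and [e] this is a single-valued relation. *)
Fixpoint run (o : baire) (e : prog) (a b : nat) : Prop :=
  match e with
  | PZero => b = 0
  | PSucc => b = a.+1
  | PFst => b = proj1n a
  | PSnd => b = proj2n a
  | POracle => b = o a
  | PPair f g => exists c d, [/\ run o f a c, run o g a d & b = npair c d]
  | PComp f g => exists2 c, run o g a c & run o f c b
  | PRec f g => rec_rel (run o f (proj1n a)) (run o g) (proj1n a) (proj2n a) b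
  | PMin f => run o f (npair a b) 0 /\
      forall k, k < b -> exists v, run o f (npair a k) v.+1
  end.

(* Independence of the oracle makes this computability without an oracle. *)
Definition computable_seq (p : baire) : Prop :=
  exists e, forall o n, run o e n (p n).

(* Partial functions on Baire space are represented by their graphs. *)
Definition type2_fun (e : prog) (p q : baire) : Prop :=
  forall n, run p e n (q n).

(* The standard representation of the continuous partial functions on Baire
   space with G_delta domain, by Kleene associates: [p] is read as a function
   on pairs (n, word), and [p] maps [q] to [r] iff, for each [n], the first
   nonzero value of [p] at (n, prefix of q), over increasing prefixes, is
   [r n + 1]. *)
Definition eta (p q r : baire) : Prop :=
  forall n, exists m,
    (forall j, j < m -> p (npair n (wcode (mkseq q j))) = 0) /\
    p (npair n (wcode (mkseq q m))) = (r n).+1.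

(** * Representations *)

(* [delta p x] means that [p] is a [delta]-name of [x]. *)
Definition naming (X : Type) : Type := baire -> X -> Prop.

Definition computable_point (X : Type) (delta : naming X) (x : X) : Prop :=
  exists2 p, computable_seq p & delta p x.

Definition meet_naming (X : Type) (delta delta' : naming X) : naming X :=
  fun p x => delta (bfst p) x /\ delta' (bsnd p) x.

Definition is_realiser (X Y : Type) (delta : naming X) (delta' : naming Y)
    (dom : set X) (f : X -> set Y) (F : baire -> baire -> Prop) : Prop :=
  forall p x, delta p x -> dom x ->
    exists2 q, F p q & exists2 y, delta' q y & f x y.

Definition computable_op (X Y : Type) (delta : naming X) (delta' : naming Y)
    (dom : set X) (f : X -> set Y) : Prop :=
  exists e, is_realiser delta delta' dom f (type2_fun e).

Definition fun_naming (X Y : Type) (delta : naming X) (delta' : naming Y) :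
    naming (X -> Y) :=
  fun p f => is_realiser delta delta' setT (fun x => [set f x]) (eta p).

(* Enumeration of the rationals strictly below [t]. *)
Definition lower_naming (R : realType) : naming (\bar R) :=
  fun p t => [set n | ((ratr (nuQ n))%:E < t)%E] = [set n | exists i, p i = n.+1].

(** * Covering dimension *)

(* Every finite cover of the subspace [K] by open sets has a finite open
   refinement any n+2 members of which have no common point in [K]. *)
Definition covering_dim_le (T : topologicalType) (K : set T) (n : nat) : Prop :=
  forall (k : nat) (U : 'I_k -> set T),
    (forall i, open (U i)) -> K `<=` \bigcup_i U i ->
    exists (m : nat) (V : 'I_m -> set T),
      [/\ forall j, open (V j),
          K `<=` \bigcup_j V j,
          forall j, exists i, K `&` V j `<=` U i
        & forall J : {set 'I_m}, n.+1 < #|J| ->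
            K `&` \bigcap_(j in [set` J]) V j = set0].

(* The class Z_c(X). *)
Definition zero_dim_compact (T : topologicalType) : set (set T) :=
  [set K | compact K /\ covering_dim_le K 0].

(** * Computable metric spaces *)

Section MetricSpace.
Variables (R : realType) (X : metricType R) (nu : nat -> X).

Definition computable_metric_space : Prop :=
  dense (range nu) /\
  exists2 g, computable_seq g &
    forall i j k,
      (`|mdist (nu i) (nu j) - ratr (nuQ (g (npair (npair i j) k)))|
         <= 2%:R ^- k :> R)%R.

Definition cauchy_naming : naming X := fun p x =>
  ((nu \o p) n @[n --> \oo] --> x) /\
  forall i j, (mdist (nu (p i)) (nu (p j)) < 2%:R ^- minn i j :> R)%R.

Definition alpha (n : nat) : set X :=
  ball (nu (proj1n n)) (ratr (nuQpos (proj2n n)) : R).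

Definition set_dist (A : set X) (x : X) : \bar R :=
  ereal_inf [set (mdist x a)%:E | a in A].

Definition range_naming : naming (set X) := fun p A =>
  closed A /\
  ((A = set0 /\ forall n, p n = 0) \/
   [/\ A !=set0,
       forall n, 1 <= p n
     & exists x : nat -> X,
         [/\ forall i, cauchy_naming (fun j => (bnth p i j).-1) (x i),
             forall i, A (x i)
           & A `<=` closure (range x)]]).

Definition dist_naming : naming (set X) := fun p A =>
  closed A /\
  is_realiser cauchy_naming (@lower_naming R) setT
    (fun x => [set set_dist A x]) (eta p).

Definition word_open (w : seq nat) : set X := \bigcup_(a in [set` w]) alpha a.

Definition formally_disjoint (u v : seq nat) : Prop :=
  forall i j, i < size u -> j < size v ->
    let a := nth 0 u i in let b := nth 0 v j in
    (ratr (nuQpos (proj2n a)) + ratr (nuQpos (proj2n b))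
       < mdist (nu (proj1n a)) (nu (proj1n b)) :> R)%R.

(* Codes of the covers of [K] by pairwise formally disjoint words. *)
Definition disj_cover_codes (K : set X) : set nat :=
  [set a | exists ws : seq (seq nat),
     [/\ a = wcode (map wcode ws),
         forall i j, i < size ws -> j < size ws -> i <> j ->
           formally_disjoint (nth [::] ws i) (nth [::] ws j)
       & K `<=` \bigcup_(w in [set` ws]) word_open w]].

Definition disj_cover_naming : naming (set X) := fun p K =>
  zero_dim_compact K /\
  [set a | exists i, p i = a.+1] = disj_cover_codes K.

(* The values E(A) of the operation E, as sets of continuous maps. *)
Definition retractions_onto (A : set X) : set (X -> X) :=
  [set f | [/\ continuous f, range f = A & forall x, A x -> f x = x]].

End MetricSpace.

(* Main.v *)
(** Given a name of a nonempty closed set A, search at every level k for an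
enumerated cover of X by formally disjoint words whose formal diameters are
below 2^-k and each of which is decided: either every ball of the word is seen
to miss A through the distance name, or some point of the range name is seen
to lie in the word. Such covers exist, since dimension zero and a Lebesgue
number split the compact space X into small clopen pieces that are uniformly
separated from each other. The retraction fixes A; a point x outside A is sent
to the point of A found in the last cell of x that meets A before the first
level at which the cell of x misses A. Following the cells of x up to level N
determines its image up to 2 * 2^-N, which gives both continuity and
computability. *)

Require Import Defs.
From mathcomp Require Import all_boot all_order all_algebra.
From mathcomp Require Import all_classical all_reals.
From mathcomp Require Import ereal topology.
From mathcomp Require Import lra zify.
From Stdlib Require Cantor.

Set Implicit Arguments.
Unset Strict Implicit.
Unset Printing Implicit Defensive.

Import Order.TTheory GRing.Theory Num.Theory.

Local Open Scope classical_set_scope.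
Local Open Scope nat_scope.

(** * Relative computability on a class of oracles *)

(** Neither half of the name decides whether a cell meets [A]: the range name only confirms meeting,
    the distance name only confirms missing. For an arbitrary cover both searches may fail, for
    instance when [A] touches the boundary of a ball without entering it. The uniform gap between
    the clopen pieces removes this case: balls of radius below the gap, centred in a piece that [A]
    misses, have centres farther from [A] than their radius. The covers of different levels come
    from independent searches and are not nested, so a cell of [x] may meet [A] again after an
    earlier one missed it. This is why the first missing level counts. The retraction may depend on
    the name of [A], since [E] is multi-valued, but not on the name of [x]. All choices made by
    search are functions of the name of [A] alone, and formal disjointness leaves exactly one cell
    of [x] at each level. *)

Lemma proj1n_npair i j : proj1n (npair i j) = i.
Proof. by rewrite /proj1n /npair Cantor.cancel_of_to. Qed.

Lemma proj2n_npair i j : proj2n (npair i j) = j.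
Proof. by rewrite /proj2n /npair Cantor.cancel_of_to. Qed.

Lemma npair_proj z : npair (proj1n z) (proj2n z) = z.
Proof. by rewrite /proj1n /proj2n /npair -surjective_pairing Cantor.cancel_to_of. Qed.

Definition npairE := (proj1n_npair, proj2n_npair).

Section Computable.
Variable D : set baire.

(** One program serves all oracles in [D]. The restriction to [D] is needed because unbounded
    searches are only guaranteed to halt on names of suitable sets. *)
Definition computable_on (F : baire -> nat -> nat) :=
  exists e, forall o, D o -> forall a, run o e a (F o a).

Lemma computable_ext F G :
  (forall o a, D o -> F o a = G o a) -> computable_on F -> computable_on G.
Proof. by move=> FG [e He]; exists e => o Do a; rewrite -FG//; exact: He. Qed.

Lemma computable_const n : computable_on (fun _ _ => n).
Proof.
elim: n => [|n [e He]]; first by exists PZero.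
by exists (PComp PSucc e) => o Do a; exists n => //; exact: He.
Qed.

Lemma computable_id : computable_on (fun _ a => a).
Proof.
exists (PPair PFst PSnd) => o Do a; exists (proj1n a), (proj2n a).
by split=> //; rewrite npair_proj.
Qed.

Lemma computable_comp F f : computable_on F -> computable_on f ->
  computable_on (fun o a => F o (f o a)).
Proof.
move=> [e He] [e' He']; exists (PComp e e') => o Do a.
by exists (f o a); [exact: He'|exact: He].
Qed.

Lemma computable_succ f : computable_on f -> computable_on (fun o a => (f o a).+1).
Proof. by apply: computable_comp (fun _ n => n.+1) _ _; exists PSucc. Qed.

Lemma computable_proj1n f :
  computable_on f -> computable_on (fun o a => proj1n (f o a)).
Proof. by apply: computable_comp (fun _ n => proj1n n) _ _; exists PFst. Qed.

Lemma computable_proj2n f :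
  computable_on f -> computable_on (fun o a => proj2n (f o a)).
Proof. by apply: computable_comp (fun _ n => proj2n n) _ _; exists PSnd. Qed.

Lemma computable_oracle f : computable_on f -> computable_on (fun o a => o (f o a)).
Proof. by apply: computable_comp (fun o n => o n) _ _; exists POracle. Qed.

Lemma computable_npair f g : computable_on f -> computable_on g ->
  computable_on (fun o a => npair (f o a) (g o a)).
Proof.
move=> [e He] [e' He']; exists (PPair e e') => o Do a.
by exists (f o a), (g o a); split=> //; [exact: He|exact: He'].
Qed.

Lemma computable_seq_comp p f : computable_seq p -> computable_on f ->
  computable_on (fun o a => p (f o a)).
Proof. by move=> [e He]; apply: computable_comp (fun _ n => p n) _ _; exists e. Qed.

Lemma computable_iter s n z : computable_on n -> computable_on z ->
  computable_on (fun o t => s o (proj1n t) (proj1n (proj2n t)) (proj2n (proj2n t))) ->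
  computable_on (fun o a => nat_rect (fun=> nat) (z o a) (s o a) (n o a)).
Proof.
move=> cn [e He] [e' He'].
suff cr : computable_on (fun o t =>
    nat_rect (fun=> nat) (z o (proj1n t)) (s o (proj1n t)) (proj2n t)).
  have := computable_comp cr (computable_npair computable_id cn).
  by apply: computable_ext => o a _; rewrite !npairE.
exists (PRec e e') => o Do t /=.
elim: (proj2n t) => [|m IH] /=; first exact: He.
exists (nat_rect (fun=> nat) (z o (proj1n t)) (s o (proj1n t)) m) => //.
by have := He' o Do (npair (proj1n t) (npair m
  (nat_rect (fun=> nat) (z o (proj1n t)) (s o (proj1n t)) m))); rewrite !npairE.
Qed.

Arguments computable_iter s {n z}.

Lemma computable_pred f : computable_on f -> computable_on (fun o a => (f o a).-1).
Proof.
move=> cf; have := computable_iter (fun _ _ k _ => k) cf (computable_const 0)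
  (computable_proj1n (computable_proj2n computable_id)).
by apply: (@computable_ext _ _) => o a _; case: (f o a).
Qed.

Lemma computable_add f g : computable_on f -> computable_on g ->
  computable_on (fun o a => f o a + g o a).
Proof.
move=> cf cg; have := computable_iter (fun _ _ _ c => c.+1) cg cf
  (computable_succ (computable_proj2n (computable_proj2n computable_id))).
by apply: computable_ext => o a _; elim: (g o a) => [|m /= ->]; rewrite ?addn0 ?addnS.
Qed.

Lemma computable_sub f g : computable_on f -> computable_on g ->
  computable_on (fun o a => f o a - g o a).
Proof.
move=> cf cg; have := computable_iter (fun _ _ _ c => c.-1) cg cf
  (computable_pred (computable_proj2n (computable_proj2n computable_id))).
by apply: computable_ext => o a _; elim: (g o a) => [|m /= ->]; rewrite ?subn0 ?subnS.
Qed.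

Lemma computable_mul f g : computable_on f -> computable_on g ->
  computable_on (fun o a => f o a * g o a).
Proof.
move=> cf cg; have := computable_iter (fun o a _ c => c + f o a) cg (computable_const 0)
  (computable_add (computable_proj2n (computable_proj2n computable_id))
                  (computable_comp cf (computable_proj1n computable_id))).
by apply: computable_ext => o a _; elim: (g o a) => [|m /= ->]; rewrite ?muln0 // mulnSr.
Qed.

Lemma computable_double f : computable_on f -> computable_on (fun o a => (f o a).*2).
Proof.
move=> cf; apply: computable_ext (computable_add cf cf) => o a _.
by rewrite addnn.
Qed.

Lemma computable_exp f g : computable_on f -> computable_on g ->
  computable_on (fun o a => f o a ^ g o a).
Proof.
move=> cf cg; have := computable_iter (fun o a _ c => f o a * c) cg (computable_const 1)
  (computable_mul (computable_comp cf (computable_proj1n computable_id))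
                  (computable_proj2n (computable_proj2n computable_id))).
by apply: computable_ext => o a _; elim: (g o a) => [|m /= ->]; rewrite ?expn0 // expnS.
Qed.

(** * Decidable and semi-decidable predicates, and search *)

Definition decidable_on (b : baire -> nat -> bool) :=
  computable_on (fun o a => nat_of_bool (b o a)).

Lemma decidable_ext b c :
  (forall o a, D o -> b o a = c o a) -> decidable_on b -> decidable_on c.
Proof. by move=> bc; apply: computable_ext => o a Do; rewrite bc. Qed.

Lemma decidable_leq f g : computable_on f -> computable_on g ->
  decidable_on (fun o a => f o a <= g o a).
Proof.
move=> cf cg; have := computable_sub (computable_const 1) (computable_sub cf cg).
by apply: computable_ext => o a _; lia.
Qed.

Lemma decidable_and b c : decidable_on b -> decidable_on c ->
  decidable_on (fun o a => b o a && c o a).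
Proof.
move=> cb cc; apply: computable_ext (computable_mul cb cc) => o a _.
by case: (b o a) (c o a) => -[].
Qed.

Lemma decidable_neg b : decidable_on b -> decidable_on (fun o a => ~~ b o a).
Proof.
move=> cb; apply: computable_ext (computable_sub (computable_const 1) cb) => o a _.
by case: (b o a).
Qed.

Lemma decidable_or b c : decidable_on b -> decidable_on c ->
  decidable_on (fun o a => b o a || c o a).
Proof.
move=> cb cc.
apply: decidable_ext (decidable_neg (decidable_and (decidable_neg cb) (decidable_neg cc))).
by move=> o a _; rewrite negb_and !negbK.
Qed.

Lemma decidable_eq f g : computable_on f -> computable_on g ->
  decidable_on (fun o a => f o a == g o a).
Proof.
move=> cf cg.
apply: decidable_ext (decidable_and (decidable_leq cf cg) (decidable_leq cg cf)).
by move=> o a _; rewrite eqn_leq.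
Qed.

Lemma computable_if b f g : decidable_on b -> computable_on f -> computable_on g ->
  computable_on (fun o a => if b o a then f o a else g o a).
Proof.
move=> cb cf cg; have := computable_add (computable_mul cb cf)
  (computable_mul (decidable_neg cb) cg).
apply: computable_ext => o a _.
by case: (b o a); rewrite ?mul1n ?mul0n ?addn0.
Qed.

Lemma decidable_has b n :
  decidable_on (fun o t => b o (proj1n t) (proj2n t)) -> computable_on n ->
  decidable_on (fun o a => has (b o a) (iota 0 (n o a))).
Proof.
move=> cb cn.
have cS : computable_on (fun o t =>
    ((proj2n (proj2n t) != 0) || b o (proj1n t) (proj1n (proj2n t)))%N).
  apply: decidable_or.
    apply: decidable_neg; apply: decidable_eq (computable_const 0).
    exact: computable_proj2n (computable_proj2n computable_id).
  apply: computable_ext (computable_comp cb (computable_npair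
    (computable_proj1n computable_id)
    (computable_proj1n (computable_proj2n computable_id)))).
  by move=> o a _; rewrite !npairE.
have := computable_iter (fun o a k c => (c != 0) || b o a k) cn (computable_const 0) cS.
apply: computable_ext => o a _; elim: (n o a) => [//|m] IH.
rewrite [LHS]/= IH -addn1 iotaD has_cat /= add0n orbF.
by case: (has _ _); case: (b _ _ _).
Qed.

Lemma decidable_all b n :
  decidable_on (fun o t => b o (proj1n t) (proj2n t)) -> computable_on n ->
  decidable_on (fun o a => all (b o a) (iota 0 (n o a))).
Proof.
move=> cb cn.
apply: decidable_ext (decidable_neg
  (decidable_has (b := fun o a k => ~~ b o a k) (decidable_neg cb) cn)).
by move=> o a _; rewrite has_predC negbK.
Qed.

Lemma computable_search b :
  decidable_on (fun o t => b o (proj1n t) (proj2n t)) ->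
  (forall o a, D o -> exists k, b o a k) ->
  exists2 h, computable_on h & forall o a, D o -> b o a (h o a).
Proof.
move=> [e He] bex.
(* The value 0 is a default for oracles outside [D], where a witness may be absent. *)
pose h o a := if pselect (exists k, b o a k) is left H then ex_minn H else 0.
have hP o a : D o -> b o a (h o a) /\ forall k, k < h o a -> ~~ b o a k.
  move=> Do; rewrite /h; case: pselect => [H|[]]; last exact: bex.
  case: ex_minnP => m bm mmin; split=> // k km.
  by apply: contraL km => /mmin; rewrite -leqNgt.
exists h => [|o a Do]; last by have [] := hP o a Do.
(* [PMin] stops at the first zero, so the program to minimise computes the negation of [b]. *)
have [e1 He1] : decidable_on (fun o t => ~~ b o (proj1n t) (proj2n t)).
  by apply: decidable_neg; exists e.
exists (PMin e1) => o Do a /=; have [bh hmin] := hP o a Do; split.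
  by have := He1 o Do (npair a (h o a)); rewrite !npairE bh.
move=> k /hmin bk; exists 0.
by have := He1 o Do (npair a k); rewrite !npairE bk.
Qed.

(** The test [b] need not be monotone in the stage [k]. *)
Definition semidecidable_on (P : baire -> nat -> Prop) :=
  exists2 b, decidable_on (fun o t => b o (proj1n t) (proj2n t)) &
    forall o a, D o -> (P o a <-> exists k, b o a k).

Lemma semidecidable_ext P Q : (forall o a, D o -> (P o a <-> Q o a)) ->
  semidecidable_on P -> semidecidable_on Q.
Proof. by move=> PQ [b cb bP]; exists b => // o a Do; rewrite -PQ// bP. Qed.

Lemma semidecidable_decidable b : decidable_on b -> semidecidable_on (fun o a => b o a).
Proof.
move=> cb; exists (fun o a _ => b o a).
  exact: computable_comp cb (computable_proj1n computable_id).
by move=> o a _; split=> [?|[]//]; exists 0.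
Qed.

Lemma semidecidable_exists P :
  semidecidable_on (fun o t => P o (proj1n t) (proj2n t)) ->
  semidecidable_on (fun o a => exists y, P o a y).
Proof.
move=> [b cb bP].
exists (fun o a k => b o (npair a (proj1n k)) (proj2n k)).
  have := computable_comp cb (computable_npair (computable_npair
    (computable_proj1n computable_id) (computable_proj1n (computable_proj2n computable_id)))
    (computable_proj2n (computable_proj2n computable_id))).
  by apply: computable_ext => o a _; rewrite !npairE.
move=> o a Do; split=> [[y]|[k bk]].
  have := bP o (npair a y) Do; rewrite !npairE => -> [k bk].
  by exists (npair y k); rewrite !npairE.
exists (proj1n k); have := bP o (npair a (proj1n k)) Do; rewrite !npairE => ->.
by exists (proj2n k).
Qed.

Lemma semidecidable_and P Q : semidecidable_on P -> semidecidable_on Q ->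
  semidecidable_on (fun o a => P o a /\ Q o a).
Proof.
move=> [b cb bP] [c cc cP].
exists (fun o a k => b o a (proj1n k) && c o a (proj2n k)).
  have cd g : decidable_on (fun o t => g o (proj1n t) (proj2n t)) ->
      forall f, computable_on f -> decidable_on (fun o t => g o (proj1n t) (f o t)).
    move=> cg f cf.
    have := computable_comp cg (computable_npair (computable_proj1n computable_id) cf).
    by apply: computable_ext => o a _; rewrite !npairE.
  apply: decidable_and.
    exact: (cd _ cb _ (computable_proj1n (computable_proj2n computable_id))).
  exact: (cd _ cc _ (computable_proj2n (computable_proj2n computable_id))).
move=> o a Do; rewrite bP// cP//; split=> [[[k bk] [l cl]]|[k /andP[bk ck]]].
  by exists (npair k l); rewrite !npairE bk.
by split; [exists (proj1n k)|exists (proj2n k)].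
Qed.

Lemma semidecidable_or P Q : semidecidable_on P -> semidecidable_on Q ->
  semidecidable_on (fun o a => P o a \/ Q o a).
Proof.
move=> [b cb bP] [c cc cP]; exists (fun o a k => b o a k || c o a k).
  exact: decidable_or.
move=> o a Do; rewrite bP// cP//; split=> [[] [k bk]|[k /orP[]bk]].
- by exists k; rewrite bk.
- by exists k; rewrite bk orbT.
- by left; exists k.
- by right; exists k.
Qed.

Lemma semidecidable_bforall P n :
  semidecidable_on (fun o t => P o (proj1n t) (proj2n t)) -> computable_on n ->
  semidecidable_on (fun o a => forall i, i < n o a -> P o a i).
Proof.
move=> [b cb bP] cn.
(* Searching all stages below [K] makes the test monotone in [K], so one bound can serve finitely
   many [i] at once. *)
exists (fun o a K => all (fun i => has (b o (npair a i)) (iota 0 K)) (iota 0 (n o a))).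
  have := @decidable_all
    (fun o t i => has (b o (npair (proj1n t) i)) (iota 0 (proj2n t))) _ _
    (computable_comp cn (computable_proj1n computable_id)).
  apply.
  have cb' : decidable_on (fun o t =>
      b o (npair (proj1n (proj1n (proj1n t))) (proj2n (proj1n t))) (proj2n t)).
    have := computable_comp cb (computable_npair (computable_npair
      (computable_proj1n (computable_proj1n (computable_proj1n computable_id)))
      (computable_proj2n (computable_proj1n computable_id))) (computable_proj2n computable_id)).
    by apply: computable_ext => o a _; rewrite !npairE.
  exact: (decidable_has (b := fun o t k =>
    b o (npair (proj1n (proj1n t)) (proj2n t)) k) cb'
    (computable_proj2n (computable_proj1n computable_id))).
move=> o a Do; split=> [H|[K /allP H] i ilt]; last first.
  have /H/hasP[k _ bk] : i \in iota 0 (n o a) by rewrite mem_iota.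
  by have := bP o (npair a i) Do; rewrite !npairE => ->; exists k.
elim: (n o a) H => [|m IH] H; first by exists 0.
have [i im|K HK] := IH; first by apply: H; rewrite ltnS ltnW.
have := bP o (npair a m) Do; rewrite !npairE => /iffLR/(_ (H m (ltnSn m)))[k bk].
exists (maxn K k.+1); rewrite -[m.+1]addn1 iotaD all_cat /= add0n andbT; apply/andP; split.
  apply: sub_all HK => i /hasP[l + bl]; rewrite mem_iota => /andP[_ lK].
  by apply/hasP; exists l => //; rewrite mem_iota leq_max (leq_trans lK).
by apply/hasP; exists k => //; rewrite mem_iota leq_max ltnSn orbT.
Qed.

(** The search runs over pairs of a value and a stage confirming it. Its result is a function of
    oracle and argument, so every later reference to a chosen cover or a chosen point sees the same
    choice. *)
Lemma semidecidable_choice P :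
  semidecidable_on (fun o t => P o (proj1n t) (proj2n t)) ->
  (forall o a, D o -> exists y, P o a y) ->
  exists2 h, computable_on h & forall o a, D o -> P o a (h o a).
Proof.
move=> [b cb bP] Pex.
have [|o a Do|h ch hP] :=
    @computable_search (fun o a k => b o (npair a (proj1n k)) (proj2n k)).
- have := computable_comp cb (computable_npair (computable_npair
    (computable_proj1n computable_id) (computable_proj1n (computable_proj2n computable_id)))
    (computable_proj2n (computable_proj2n computable_id))).
  by apply: computable_ext => o a _; rewrite !npairE.
- have [y] := Pex o a Do; have := bP o (npair a y) Do; rewrite !npairE => -> [k bk].
  by exists (npair y k); rewrite !npairE.
exists (fun o a => proj1n (h o a)); first exact: computable_proj1n.
move=> o a Do; have := bP o (npair a (proj1n (h o a))) Do; rewrite !npairE => ->.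
by exists (proj2n (h o a)); exact: hP.
Qed.

(* [CodeSeq.code] encodes [n :: s] by [2 ^ n * t.*2.+1], where [t] encodes [s]. *)
Lemma computable_uncons : exists2 h, computable_on h & forall o c, D o -> 0 < c ->
  CodeSeq.decode c = proj1n (h o c) :: CodeSeq.decode (proj2n (h o c)).
Proof.
have [|o c Do|h ch hP] := @computable_search
    (fun _ c k => (c == 0) || (c == 2 ^ proj1n k * (proj2n k).*2.+1)).
- have c1 := computable_proj1n computable_id; have c2 := computable_proj2n computable_id.
  apply: decidable_or (decidable_eq c1 (computable_const 0)) (decidable_eq c1 _).
  apply: computable_mul (computable_exp (computable_const 2) (computable_proj1n c2)) _.
  exact/computable_succ/computable_double/computable_proj2n.
- case: (posnP c) => [->|c0]; first by exists 0.
  have := CodeSeq.decodeK c; case: (CodeSeq.decode c) => [|n s] /=.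
    by move=> c'; rewrite -c' in c0.
  by move=> <-; exists (npair n (CodeSeq.code s)); rewrite !npairE eqxx ?orbT.
exists h => // o c Do c0; have := hP o c Do.
rewrite eqn0Ngt c0 /= => /eqP {1}->.
by rewrite -{1}[proj2n (h o c)]CodeSeq.decodeK -[LHS]/(CodeSeq.decode
  (CodeSeq.code (_ :: CodeSeq.decode (proj2n (h o c))))) CodeSeq.codeK.
Qed.

Lemma computable_drop : exists2 d, computable_on d &
  forall o c i, D o -> CodeSeq.decode (d o (npair c i)) = drop i (CodeSeq.decode c).
Proof.
have [h ch hP] := computable_uncons.
have c22 := computable_proj2n (computable_proj2n computable_id).
(* The code 0 is the empty word, on which [h] is unspecified; dropping from it must give 0 again. *)
have cs : computable_on (fun o t => if proj2n (proj2n t) == 0 then 0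
    else proj2n (h o (proj2n (proj2n t)))).
  apply: computable_if (computable_const 0) (computable_proj2n (computable_comp ch c22)).
  exact: decidable_eq c22 (computable_const 0).
have cr := computable_iter (fun o a k c => if c == 0 then 0 else proj2n (h o c))
  (computable_proj2n computable_id) (computable_proj1n computable_id) cs.
eexists; first exact: cr.
move=> o c i Do /=; rewrite !npairE; elim: i => [|i IH]; first by rewrite drop0.
rewrite [nat_rect _ _ _ _]/= -addn1 addnC -drop_drop -IH.
set c' := nat_rect _ _ _ _; case: (posnP c') => [->//|c0].
by rewrite (hP o _ Do c0) /= drop0.
Qed.

Lemma decode_eq0 c : (CodeSeq.decode c == [::]) = (c == 0).
Proof.
by apply/eqP/eqP => [c0|->//]; rewrite -[c]CodeSeq.decodeK c0.
Qed.

Lemma computable_nth c i : computable_on c -> computable_on i ->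
  computable_on (fun o a => nth 0 (CodeSeq.decode (c o a)) (i o a)).
Proof.
move=> cc ci; have [d cd dP] := computable_drop; have [h ch hP] := computable_uncons.
have cD := computable_comp cd (computable_npair cc ci).
have := computable_if (decidable_eq cD (computable_const 0)) (computable_const 0)
  (computable_proj1n (computable_comp ch cD)).
apply: computable_ext => o a Do; rewrite -[in RHS](addn0 (i o a)) -nth_drop -(dP o)// nth0.
set e := d _ _; case: (posnP e) => [->//|e0].
by rewrite (hP o _ Do e0).
Qed.

(** The length is the first index with an empty suffix. Both conditions are decidable from [drop]
    alone, so the length can be found by search. *)
Lemma eq_size_drop (s : seq nat) k :
  (k == size s) = (drop k s == [::]) && ((k == 0) || (drop k.-1 s != [::])).
Proof.
by rewrite -!size_eq0 !size_drop; case: k => [|k] /=; lia.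
Qed.

Lemma computable_size c : computable_on c ->
  computable_on (fun o a => size (CodeSeq.decode (c o a))).
Proof.
move=> cc; have [d cd dP] := computable_drop.
suff [h ch hP] : exists2 h, computable_on h & forall o a, D o ->
    h o a == size (CodeSeq.decode (c o a)).
  by apply: computable_ext ch => o a Do; exact/eqP/hP.
apply: (@computable_search (fun o a k => k == size (CodeSeq.decode (c o a)))); last first.
  by move=> o a _; exists (size (CodeSeq.decode (c o a))).
have c1 := computable_comp cc (computable_proj1n computable_id).
have c2 := computable_proj2n computable_id.
apply: decidable_ext (decidable_and
  (decidable_eq (computable_comp cd (computable_npair c1 c2)) (computable_const 0))
  (decidable_or (decidable_eq c2 (computable_const 0)) (decidable_neg
  (decidable_eq (computable_comp cd (computable_npair c1 (computable_pred c2)))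
     (computable_const 0))))) => o a Do.
by rewrite eq_size_drop -!(dP o)// !decode_eq0.
Qed.

(** These are the prefixes of the constant name of a point [nu c], on which the distance name will
    be evaluated. *)
Lemma computable_code_nseq n c : computable_on n -> computable_on c ->
  computable_on (fun o a => wcode (nseq (n o a) (c o a))).
Proof.
move=> cn cc; have := computable_iter (fun o a _ w => 2 ^ c o a * w.*2.+1) cn (computable_const 0)
  (computable_mul
     (computable_exp (computable_const 2) (computable_comp cc (computable_proj1n computable_id)))
     (computable_succ (computable_double (computable_proj2n (computable_proj2n computable_id))))).
by apply: computable_ext => o a _; elim: (n o a) => //= m ->.
Qed.

(* Rational-valued functions given by numerators, as differences of naturals,
   and denominators. *)
Definition rat_computable_on (F : baire -> nat -> rat) :=
  exists f g h, [/\ computable_on f, computable_on g, computable_on h &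
    forall o a, D o -> F o a = (((f o a)%:R - (g o a)%:R) / (h o a).+1%:R)%R].

Lemma rat_computable_nuQ f : computable_on f -> rat_computable_on (fun o a => nuQ (f o a)).
Proof.
move=> cf; exists (fun o a => proj1n (proj1n (f o a))), (fun o a => proj2n (proj1n (f o a))),
  (fun o a => proj2n (f o a)); split=> //.
- exact/computable_proj1n/computable_proj1n.
- exact/computable_proj2n/computable_proj1n.
- exact/computable_proj2n.
Qed.

Lemma rat_computable_nuQpos f :
  computable_on f -> rat_computable_on (fun o a => nuQpos (f o a)).
Proof.
move=> cf; exists (fun o a => (proj1n (f o a)).+1), (fun _ _ => 0),
  (fun o a => proj2n (f o a)); split=> //.
- exact/computable_succ/computable_proj1n.
- exact: computable_const.
- exact/computable_proj2n.
- by move=> o a _; rewrite subr0.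
Qed.

Lemma rat_computable_expVn f :
  computable_on f -> rat_computable_on (fun o a => (2%:R ^- f o a)%R).
Proof.
move=> cf; exists (fun _ _ => 1), (fun _ _ => 0), (fun o a => (2 ^ f o a).-1); split.
- exact: computable_const.
- exact: computable_const.
- exact/computable_pred/computable_exp/cf/computable_const.
- by move=> o a _; rewrite prednK ?expn_gt0// subr0 div1r natrX.
Qed.

Lemma rat_computable_opp F : rat_computable_on F -> rat_computable_on (fun o a => - F o a)%R.
Proof.
move=> [f [g [h [cf cg ch FE]]]]; exists g, f, h; split=> // o a Do.
by rewrite FE// -mulNr opprB.
Qed.

Lemma rat_computable_add F G : rat_computable_on F -> rat_computable_on G ->
  rat_computable_on (fun o a => F o a + G o a)%R.
Proof.
move=> [f [g [h [cf cg ch FE]]]] [f' [g' [h' [cf' cg' ch' GE]]]].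
have cS := computable_succ ch; have cS' := computable_succ ch'.
exists (fun o a => f o a * (h' o a).+1 + f' o a * (h o a).+1),
       (fun o a => g o a * (h' o a).+1 + g' o a * (h o a).+1),
       (fun o a => ((h o a).+1 * (h' o a).+1).-1); split=> [| | |o a Do].
- exact: computable_add (computable_mul cf cS') (computable_mul cf' cS).
- exact: computable_add (computable_mul cg cS') (computable_mul cg' cS).
- exact: computable_pred (computable_mul cS cS').
rewrite FE// GE// prednK ?muln_gt0// addf_div ?pnatr_eq0// !natrD !natrM.
by congr (_ / _)%R; lra.
Qed.

Lemma decidable_rat_lt F G : rat_computable_on F -> rat_computable_on G ->
  decidable_on (fun o a => F o a < G o a)%R.
Proof.
move=> cF cG; have [f [g [h [cf cg ch FE]]]] := rat_computable_add cG (rat_computable_opp cF).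
apply: decidable_ext (decidable_leq (computable_succ cg) cf) => o a Do.
by rewrite -[RHS]subr_gt0 FE// pmulr_lgt0 ?invr_gt0 ?ltr0n// subr_gt0 ltr_nat.
Qed.

Lemma decidable_rat_le F G : rat_computable_on F -> rat_computable_on G ->
  decidable_on (fun o a => F o a <= G o a)%R.
Proof.
move=> cF cG; apply: decidable_ext (decidable_neg (decidable_rat_lt cG cF)) => o a Do.
by rewrite -leNgt.
Qed.

End Computable.

(** * Retractions from decided disjoint covers *)

Section Metric.
Local Open Scope ring_scope.
Variables (R : realType) (X : metricType R) (nu : nat -> X).
Implicit Types (A : set X) (b k : nat) (w : seq nat) (ws : seq (seq nat)).

Definition center b : X := nu (proj1n b).
Definition radius b : R := ratr (nuQpos (proj2n b)).

Lemma nuQpos_gt0 n : 0 < nuQpos n.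
Proof. by rewrite /nuQpos divr_gt0 ?ltr0n. Qed.

Lemma ex_expVn_lt (e : R) : 0 < e -> exists n, 2%:R ^- n < e.
Proof.
move=> e0; exists (Num.truncn e^-1); rewrite -[ltRHS]invrK ltf_pV2 ?posrE ?exprn_gt0 ?invr_gt0//.
have/andP[_] := truncn_itv (ltW (etrans (invr_gt0 e) e0)).
move/lt_le_trans; apply; rewrite -natrX ler_nat; exact: ltn_expl.
Qed.

Lemma expVnS n : 2%:R ^- n = 2%:R ^- n.+1 + 2%:R ^- n.+1 :> R.
Proof. by rewrite exprS invfM; lra. Qed.

Lemma expVn_gt0 n : 0 < 2%:R ^- n :> R.
Proof. by rewrite invr_gt0 exprn_gt0. Qed.

Lemma le_expVn m n : (m <= n)%N -> 2%:R ^- n <= 2%:R ^- m :> R.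
Proof. by move=> mn; rewrite lef_pV2 ?posrE ?exprn_gt0// ler_weXn2l ?ler1n. Qed.

Lemma ex_nuQpos_lt (e : R) : 0 < e -> exists n, ratr (nuQpos n) < e :> R.
Proof.
move=> /ex_expVn_lt[n ne]; exists (npair 0 (2 ^ n).-1).
by rewrite /nuQpos !npairE prednK ?expn_gt0// div1r fmorphV /= natrX rmorphXn /= ratr_nat.
Qed.

Lemma in_ball (x y : X) (r : R) : ball x r y <-> mdist x y < r.
Proof. by rewrite ballEmdist. Qed.

Lemma word_openP w x : word_open nu w x <->
  exists2 l, (l < size w)%N & mdist (center (nth 0%N w l)) x < radius (nth 0%N w l).
Proof.
split=> [[b /= bw /in_ball bx]|[l lw lx]].
  by exists (index b w); rewrite ?index_mem// nth_index.
by exists (nth 0%N w l); [exact: mem_nth|exact/in_ball].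
Qed.

Lemma formally_disjoint_word_open u v x : formally_disjoint nu u v ->
  word_open nu u x -> word_open nu v x -> False.
Proof.
move=> uv /word_openP[i iu ix] /word_openP[j jv jx].
have := uv i j iu jv; apply/negP; rewrite -leNgt.
apply: le_trans (metric_triangle _ x _) _.
by rewrite lerD ?ltW// metric_sym.
Qed.

(** A bound on the formal diameter. Referring to centres and radii only, it is semi-decidable; the
    radii stand on the right so that a distance is compared with a rational. *)
Definition small_word k w := forall i j, (i < size w)%N -> (j < size w)%N ->
  mdist (center (nth 0%N w i)) (center (nth 0%N w j))
    < 2%:R ^- k - radius (nth 0%N w i) - radius (nth 0%N w j).

Lemma small_wordP k w x y : small_word k w ->
  word_open nu w x -> word_open nu w y -> mdist x y < 2%:R ^- k.
Proof.
move=> sw /word_openP[i iw ix] /word_openP[j jw jy].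
have := sw i j iw jw.
have := metric_triangle x (center (nth 0%N w i)) y.
have := metric_triangle (center (nth 0%N w i)) (center (nth 0%N w j)) y.
by rewrite (metric_sym x (center _)); lra.
Qed.

Lemma open_word_open w : open (word_open nu w).
Proof.
rewrite openE => x /word_openP[i iw ix].
apply/nbhs_ballP; exists (radius (nth 0%N w i) - mdist (center (nth 0%N w i)) x) => /=.
  by rewrite subr_gt0.
move=> y /in_ball xy; apply/word_openP; exists i => //.
by apply: le_lt_trans (metric_triangle _ x _) _; lra.
Qed.

(** Both alternatives are strict or open conditions, so that a name of [A] can confirm whichever
    holds. *)
Definition decided_word A w :=
  (forall l, (l < size w)%N ->
     ((radius (nth 0%N w l))%:E < set_dist A (center (nth 0%N w l)))%E) \/
  exists2 y, A y & word_open nu w y.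

Lemma missed_word A w y :
  (forall l, (l < size w)%N ->
     ((radius (nth 0%N w l))%:E <= set_dist A (center (nth 0%N w l)))%E) ->
  A y -> ~ word_open nu w y.
Proof.
move=> wA Ay /word_openP[l lw ly]; have := wA l lw; apply/negP; rewrite -ltNge.
apply: (@le_lt_trans _ _ (mdist (center (nth 0%N w l)) y)%:E); last by rewrite lte_fin.
by apply: ereal_inf_lbound; exists y.
Qed.

(** * Existence of decided covers from compactness and dimension zero *)

Section Cover.
Hypotheses (nu_dense : dense (range nu)) (X_compact : compact [set: X]).

Lemma ex_nu_near (x : X) (e : R) : 0 < e -> exists c, mdist (nu c) x < e.
Proof.
move=> e0; have xe : nbhs x (ball x e) by exact: nbhsx_ballx.
have [|z [/interior_subset/in_ball ye [c _ cE]]] := nu_dense _ (open_interior (ball x e)).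
  by exists x.
by exists c; rewrite cE metric_sym.
Qed.

Lemma finite_nu_cover (e : R) : 0 < e ->
  exists n, forall x, exists2 c, (c < n)%N & mdist (nu c) x < e.
Proof.
(* Near-covering form of compactness: what holds for all points near each [x] and all large [n]
   holds, from some [n] on, for all points at once. *)
move=> e0; have /compact_near_coveringP := X_compact.
move=> /(_ nat \oo (fun n x => exists2 c, (c < n)%N & mdist (nu c) x < e) _).
case=> [x _|N _ NP]; last by exists N => x; apply: NP => //=.
have e20 : 0 < e / 2 by rewrite divr_gt0.
have [c cx] := ex_nu_near x e20.
exists ([set y | mdist x y < e / 2], [set n | (c < n)%N]) => /=.
  split; last by exists c.+1.
  have := nbhsx_ballx x _ e20; by apply: filterS => y /in_ball.
move=> [y n] /= [xy cn]; exists c => //.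
by apply: le_lt_trans (metric_triangle _ x _) _; lra.
Qed.

(** For a disjoint cover a Lebesgue number is a uniform gap: a small ball around a point lies in
    some piece, and disjointness forces this to be the piece of the point. *)
Lemma lebesgue_number m (V : 'I_m -> set X) :
  (forall j, open (V j)) -> [set: X] `<=` \bigcup_j V j ->
  (forall i j x, V i x -> V j x -> i = j) ->
  exists2 e : R, 0 < e & forall j x y, V j x -> mdist x y < e -> V j y.
Proof.
move=> Vo Vcov Vdisj; have /compact_near_coveringP := X_compact.
move=> /(_ nat \oo
  (fun n x => forall j y, V j x -> mdist x y < 2%:R ^- n -> V j y) _).
case=> [x _|N _ NP]; last first.
  exists (2%:R ^- N); first exact: expVn_gt0.
  by move=> j x y; apply: (NP N) => //=.
have [j _ Vjx] := Vcov x I.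
have /nbhs_ballP[r /= r0 rV] : nbhs x (V j) by exact: open_nbhs_nbhs.
have r20 : 0 < r / 2 by rewrite divr_gt0.
have [N Nr] := ex_expVn_lt r20.
exists ([set y | mdist x y < r / 2], [set n | (N <= n)%N]) => /=.
  split; last by exists N.
  have := nbhsx_ballx x _ r20; by apply: filterS => y /in_ball.
move=> [y n] /= [xy Nn] i z Viy yz.
have <- : j = i by apply: Vdisj Viy; apply/rV/in_ball; lra.
apply/rV/in_ball; apply: le_lt_trans (metric_triangle _ y _) _.
by have := le_expVn Nn; lra.
Qed.

Lemma ex_decided_cover A k : covering_dim_le [set: X] 0 -> exists ws,
  [/\ forall i j, (i < size ws)%N -> (j < size ws)%N -> i <> j ->
        formally_disjoint nu (nth [::] ws i) (nth [::] ws j),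
      [set: X] `<=` \bigcup_(w in [set` ws]) word_open nu w,
      forall w, w \in ws -> small_word k w
    & forall w, w \in ws -> decided_word A w].
Proof.
(* The pieces will have diameter below [2e] and the balls radius below [e], so the formal diameter
   stays below [4e], which is [2 ^- k]. *)
move=> dim0; pose e : R := 2%:R ^- k.+2.
have e0 : 0 < e by exact: expVn_gt0.
have [n ncov] := finite_nu_cover e0.
have [||m [V [Vo Vcov Vref Vdisj]]] := dim0 n (fun i => (ball (nu i) e)^°).
- by move=> i; exact: open_interior.
- move=> x _; have [c cn cx] := ncov x; exists (Ordinal cn) => //=.
  rewrite /interior; apply/nbhs_ballP; exists (e - mdist (nu c) x) => /=.
    by rewrite subr_gt0.
  move=> y /in_ball xy; apply/in_ball.
  by apply: le_lt_trans (metric_triangle _ x _) _; lra.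
(* Dimension zero, applied to a two-element index set, makes the refinement disjoint. *)
have {}Vdisj i j x : V i x -> V j x -> i = j.
  move=> Vix Vjx; apply/eqP/negPn/negP => ij.
  have : set0 x; last by [].
  rewrite -(Vdisj [set i; j]%SET); last by rewrite cards2 ij.
  by split=> // l /=; rewrite !inE => /orP[] /eqP->.
have {}Vref j x y : V j x -> V j y -> mdist x y < e + e.
  have [i Vi] := Vref j => Vx Vy.
  have /interior_subset/in_ball := Vi x (conj I Vx).
  have /interior_subset/in_ball := Vi y (conj I Vy).
  have := metric_triangle x (nu i) y; rewrite (metric_sym x (nu i)); lra.
have [d d0 dP] := lebesgue_number Vo Vcov Vdisj.
(* The bound [d / 2] makes two radii sum to less than the gap, which gives formal disjointness; the
   bound [e] gives smallness. *)
have [|r rlt] := @ex_nuQpos_lt (Num.min (d / 2) e).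
  by rewrite lt_min e0 andbT divr_gt0.
set rho : R := ratr (nuQpos r) in rlt.
have [rd re] : rho < d / 2 /\ rho < e by apply/andP; rewrite -lt_min.
have rho0 : 0 < rho by rewrite /rho ltr0q nuQpos_gt0.
have [s scov] := finite_nu_cover rho0.
(* Membership in [V j] is decided classically: the word only has to exist, since the algorithm will
   find a suitable cover by search. *)
pose word j := [seq npair c r | c <- iota 0 s & `[< V j (nu c) >]].
have wordP j l : (l < size (word j))%N ->
    V j (center (nth 0%N (word j) l)) /\ radius (nth 0%N (word j) l) = rho.
  move=> /(mem_nth 0%N)/mapP[c]; rewrite mem_filter => /andP[/asboolP Vc _] ->.
  by rewrite /center /radius !npairE.
have wordx j x : V j x -> word_open nu (word j) x.
  move=> Vx; have [c cs cx] := scov x.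
  exists (npair c r); last by apply/in_ball; rewrite !npairE.
  apply/mapP; exists c => //; rewrite mem_filter mem_iota /= cs andbT.
  by apply/asboolP; apply: dP Vx _; rewrite metric_sym; lra.
exists [seq word j | j <- enum 'I_m]; split.
- move=> i j; rewrite !(size_map word) size_enum_ord => im jm ij.
  rewrite (nth_map (Ordinal im)) ?size_enum_ord// (nth_map (Ordinal jm)) ?size_enum_ord//.
  set i' := nth _ _ i; set j' := nth _ _ j => p q pw qw.
  rewrite /formally_disjoint -/(radius _) -/(radius _) -!/(center _).
  have [Va ra] := wordP _ _ pw; have [Vb rb] := wordP _ _ qw.
  rewrite ra rb; have : d <= mdist (center (nth 0%N (word i') p)) (center (nth 0%N (word j') q)).
    rewrite leNgt; apply/negP => /(dP _ _ _ Va) /(Vdisj _ _ _ Vb) /(congr1 (@nat_of_ord m)).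
    by rewrite /i' /j' !nth_enum_ord// => /esym.
  by lra.
- move=> x _; have [j _ Vx] := Vcov x I.
  exists (word j); last exact: wordx.
  by apply/mapP; exists j => //; rewrite mem_enum.
- move=> _ /mapP[j _ ->] p q pw qw.
  have [Va ra] := wordP _ _ pw; have [Vb rb] := wordP _ _ qw.
  rewrite ra rb; have := Vref _ _ _ Va Vb.
  by rewrite (expVnS k) (expVnS k.+1) -/e; lra.
- move=> _ /mapP[j _ ->].
  (* If [A] misses [V j], the gap keeps [A] at distance at least [d] from every centre, and [d]
     exceeds the common radius [rho]. *)
  have [[y [Ay Vy]]|VA] := pselect (exists y, A y /\ V j y).
    by right; exists y => //; exact: wordx.
  left=> l /wordP[Vl ->]; apply: (@lt_le_trans _ _ d%:E); first by rewrite lte_fin; lra.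
  apply: le_ereal_inf_tmp => _ [y Ay <-]; rewrite lee_fin leNgt; apply/negP => yd.
  by apply: VA; exists y; split => //; exact: dP yd.
Qed.

End Cover.

(* At stage [K] the cell [s k] is known to meet [A] for all [k < K], and either
   [K] is the last level considered or the cell [s K] misses [A]; the point
   selected is the one found in the last cell known to meet [A]. *)
Definition stopped (h : nat -> nat -> nat) (s : nat -> nat) (N K : nat) :=
  [/\ (K <= N)%N, forall j, (j < K)%N -> (0 < h j (s j))%N & K = N \/ h K (s K) = 0%N].

Definition selected (h : nat -> nat -> nat) (s : nat -> nat) (K : nat) : nat :=
  if K is k.+1 then (h k (s k)).-1 else 0.

Lemma ex_stopped h s N : exists K, stopped h s N K.
Proof.
have [[k [kN hk]]|H] := pselect (exists k, (k < N)%N /\ h k (s k) = 0%N); last first.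
  exists N; split=> //; last by left.
  by move=> j jN; rewrite lt0n; apply/eqP => hj; apply: H; exists j.
have ex : exists k, h k (s k) == 0%N by exists k; rewrite hk.
case: (ex_minnP ex) => K /eqP hK Kmin; exists K; split.
- by rewrite (leq_trans (Kmin k _)) ?hk// ltnW.
- by move=> j jK; rewrite lt0n; apply: contraL jK => /Kmin; rewrite -leqNgt.
- by right.
Qed.

Lemma stopped_ext h s s' N K : (forall k, (k < N)%N -> s k = s' k) ->
  stopped h s N K -> stopped h s' N K /\ selected h s' K = selected h s K.
Proof.
move=> ss' [KN hK hN]; split; first split=> //.
- by move=> j jK; rewrite -ss' ?hK// (leq_trans jK).
- by move: KN; rewrite leq_eqVlt => /orP[/eqP|KN]; [left|rewrite -ss'].
- by case: K KN {hK hN} => //= k kN; rewrite ss'.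
Qed.

(** * The retraction determined by a sequence of decided covers *)

Section Retraction.
Variables (A : set X) (ws : nat -> seq (seq nat)) (h : nat -> nat -> nat) (y : nat -> X).
Hypotheses (A_closed : closed A) (yA : forall i, A (y i)).
Hypothesis ws_disjoint : forall k i j, (i < size (ws k))%N -> (j < size (ws k))%N ->
  i <> j -> formally_disjoint nu (nth [::] (ws k) i) (nth [::] (ws k) j).
Hypothesis ws_cover : forall k, [set: X] `<=` \bigcup_(w in [set` ws k]) word_open nu w.
Hypothesis ws_small : forall k w, w \in ws k -> small_word k w.
Hypothesis h_miss : forall k j z, (j < size (ws k))%N -> h k j = 0%N ->
  A z -> ~ word_open nu (nth [::] (ws k) j) z.
Hypothesis h_meet : forall k j i, (j < size (ws k))%N -> h k j = i.+1 ->
  word_open nu (nth [::] (ws k) j) (y i).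

Let in_cell k j x := (j < size (ws k))%N /\ word_open nu (nth [::] (ws k) j) x.

Let cells : exists c : X -> nat -> nat, forall x k, in_cell k (c x k) x.
Proof.
suff /choice[c cP] : forall xk : X * nat, exists j, in_cell xk.2 j xk.1.
  by exists (fun x k => c (x, k)) => x k; exact: (cP (x, k)).
move=> [x k]; have [w /= wk wx] := ws_cover k (I : [set: X] x).
by exists (index w (ws k)); rewrite /in_cell index_mem nth_index.
Qed.

Let cell_unique k i j x : in_cell k i x -> in_cell k j x -> i = j.
Proof.
move=> [ik xi] [jk xj]; have [//|/eqP ij] := eqVneq i j.
by have := formally_disjoint_word_open (ws_disjoint ik jk ij) xi xj.
Qed.

Let selected_near N x s K : in_cell K (s K) x -> (N <= K)%N -> (0 < h K (s K))%N ->
  mdist (y (selected h s K.+1)) x < 2%:R ^- N.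
Proof.
move=> [jK xj] NK; case E : (h K (s K)) => [//|i] _ /=; rewrite E /=.
apply: lt_le_trans (le_expVn NK).
by apply: (small_wordP (ws_small (mem_nth [::] jK))) => //; exact: h_meet.
Qed.

Lemma ex_retraction : exists2 f, retractions_onto A f &
  forall N x s K, (forall k, (k <= N)%N ->
      (s k < size (ws k))%N /\ word_open nu (nth [::] (ws k) (s k)) x) ->
    stopped h s N.+1 K -> mdist (y (selected h s K)) (f x) <= 2%:R ^- N + 2%:R ^- N.
Proof.
have [c cP] := cells.
have /choice[f fP] x : exists z, (A x /\ z = x) \/
    (~ A x /\ exists K, [/\ forall j, (j < K)%N -> (0 < h j (c x j))%N, h K (c x K) = 0%N
      & z = y (selected h (c x) K)]).
  have [Ax|nAx] := pselect (A x); first by exists x; left.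
  have [exk|H] := pselect (exists k, h k (c x k) == 0%N).
    case: (ex_minnP exk) => K /eqP hK Kmin.
    exists (y (selected h (c x) K)); right; split=> //; exists K; split=> //.
    by move=> j jK; rewrite lt0n; apply: contraL jK => /Kmin; rewrite -leqNgt.
  (* If no cell of [x] missed [A], the points found in ever smaller cells would converge to [x], and
     closedness would put [x] in [A]. *)
  exfalso; apply: nAx; rewrite (iffLR (closure_id A) A_closed).
  move=> B /nbhs_ballP[e /= e0 eB]; have [n ne] := ex_expVn_lt e0.
  exists (y (selected h (c x) n.+1)); split=> //; apply/eB/in_ball; rewrite metric_sym.
  apply: lt_trans ne; apply: selected_near => //.
  by rewrite lt0n; apply/negP => hn; apply: H; exists n.
have fA x : A (f x) by case: (fP x) => -[Ax]; [move=> ->|move=> [K [_ _ ->]]].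
have fid x : A x -> f x = x by case: (fP x) => -[].
have approx N x s K : (forall k, (k <= N)%N -> in_cell k (s k) x) ->
    stopped h s N.+1 K -> mdist (y (selected h s K)) (f x) <= 2%:R ^- N + 2%:R ^- N.
  move=> sx /(@stopped_ext _ _ (c x)) [k kN|]; first exact: cell_unique (sx _ kN) (cP _ _).
  move=> [KN hK hN] <-; have e0 : 0 <= 2%:R ^- N + 2%:R ^- N :> R.
    by rewrite addr_ge0// ltW// expVn_gt0.
  (* For [x] in [A] no cell of [x] misses [A], so only the cut-off [K = N.+1] can stop the walk. For
     [x] outside [A], with first missing level [L], the walk stops at [L] or is cut off before
     it. *)
  case: (fP x) => [[Ax ->]|[nAx [L [hL hL0 ->]]]].
    case: hN => [KE|hK0]; last first.
      by have [cK xK] := cP x K; have := h_miss cK hK0 Ax xK.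
    rewrite KE; apply: (@le_trans _ _ (2%:R ^- N)); last by rewrite lerDl ltW// expVn_gt0.
    by apply/ltW/selected_near => //; apply: hK; rewrite KE.
  have KL : (K <= L)%N.
    by rewrite leqNgt; apply/negP => /hK; rewrite hL0.
  (* Equal stops select the same point, even at stage 0, where the default index 0 names an
     arbitrary point of [A]. Otherwise [K = N.+1], and both selected points are within [2 ^- N] of
     [x]. *)
  have [->|/eqP nKL] := eqVneq K L; first by rewrite mdistxx.
  have {}KL : (K < L)%N by rewrite ltn_neqAle KL andbT; apply/eqP.
  case: hN => [KE|hK0]; last by have := hL _ KL; rewrite hK0.
  case: L KL hL hL0 {nKL} => // L; rewrite KE ltnS => NL hL _.
  apply: le_trans (metric_triangle _ x _) _; apply: lerD; apply: ltW.
    by apply: selected_near => //; apply: hK; rewrite KE.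
  rewrite metric_sym; apply: selected_near => //; last exact: hL.
  exact: ltnW.
exists f => //; split=> //; last first.
  by apply/seteqP; split=> [_ [x _ <-]//|x Ax]; exists x => //; exact: fid.
move=> x; apply/cvg_ballP => e e0.
(* Near [x] the first cells are shared, so [f x] and [f z] are each within [2 * 2 ^- n] of one
   common selected point. *)
have [n ne] : exists n, 2%:R ^- n < e / 4 by apply: ex_expVn_lt; rewrite divr_gt0.
have near_cells N : \forall z \near x, forall k, (k < N)%N -> in_cell k (c x k) z.
  elim: N => [|N IH]; first by apply: nearW.
  have [cN xN] := cP x N.
  have : nbhs x (word_open nu (nth [::] (ws N) (c x N))).
    exact: open_nbhs_nbhs (conj (@open_word_open _) xN).
  apply: filterS2 IH => z zk zN k; rewrite ltnS leq_eqVlt => /orP[/eqP->|/zk//].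
  by split.
have [K cK] := ex_stopped h (c x) n.+1.
have := near_cells n.+1; apply: filterS => z zc; apply/in_ball.
have := approx n z (c x) K zc cK.
have := approx n x (c x) K (fun k _ => cP x k) cK.
have := metric_triangle (f x) (y (selected h (c x) K)) (f z).
by rewrite (metric_sym (f x) (y _)); lra.
Qed.

End Retraction.
End Metric.

(** * Computing the covers and the retraction *)

Lemma semidecidable_eq D f g : computable_on D f -> computable_on D g ->
  semidecidable_on D (fun o a => f o a = g o a).
Proof.
move=> cf cg; apply: semidecidable_ext (semidecidable_decidable (decidable_eq cf cg)).
by move=> o a _; split=> /eqP.
Qed.

Lemma computable_selected D h s K :
  computable_on D (fun o t => h o (proj1n t) (proj2n t)) ->
  computable_on D (fun o t => s o (proj1n t) (proj2n t)) -> computable_on D K ->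
  computable_on D (fun o a => selected (h o) (s o a) (K o a)).
Proof.
move=> ch cs cK; have cs' : computable_on D (fun o a => s o a (K o a).-1).
  have := computable_comp cs (computable_npair (computable_id _) (computable_pred cK)).
  by apply: computable_ext => o a _; rewrite !npairE.
have ch' : computable_on D (fun o a => h o (K o a).-1 (s o a (K o a).-1)).
  have := computable_comp ch (computable_npair (computable_pred cK) cs').
  by apply: computable_ext => o a _; rewrite !npairE.
apply: computable_ext (computable_if (decidable_eq cK (computable_const _ 0))
  (computable_const _ 0) (computable_pred ch')) => o a _.
by case: (K o a).
Qed.

(** Comparisons of distances are left open, being only semi-decidable; other boolean tests are
    treated as decidable. Goals that match no rule and are not constants are also left open. *)
Ltac computability := cbv beta;
  lazymatch goal with
  | |- semidecidable_on _ (fun o a => _ /\ _) => apply: semidecidable_and; computability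
  | |- semidecidable_on _ (fun o a => _ \/ _) => apply: semidecidable_or; computability
  | |- semidecidable_on _ (fun o a => exists y, _) =>
      apply: semidecidable_exists; computability
  | |- semidecidable_on _ (fun o a => _ = true) =>
      apply: semidecidable_decidable; computability
  | |- semidecidable_on _ (fun o a => is_true (mdist _ _ < _)%R) => idtac
  | |- semidecidable_on _ (fun o a => is_true _) =>
      apply: semidecidable_decidable; computability
  | |- semidecidable_on _ (fun o a => _ = _) => apply: semidecidable_eq; computability
  | |- semidecidable_on _ (fun o a => forall i, is_true (i < _) -> _) =>
      apply: semidecidable_bforall; computability
  | |- decidable_on _ (fun o a => _ && _) => apply: decidable_and; computability
  | |- decidable_on _ (fun o a => _ || _) => apply: decidable_or; computability
  | |- decidable_on _ (fun o a => ~~ _) => apply: decidable_neg; computability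
  | |- decidable_on _ (fun o a => _ <= _) => apply: decidable_leq; computability
  | |- decidable_on _ (fun o a => _ == _) => apply: decidable_eq; computability
  | |- decidable_on _ (fun o a => (_ < _)%R) => apply: decidable_rat_lt; computability
  | |- decidable_on _ (fun o a => (_ <= _)%R) => apply: decidable_rat_le; computability
  | |- rat_computable_on _ (fun o a => nuQ _) => apply: rat_computable_nuQ; computability
  | |- rat_computable_on _ (fun o a => nuQpos _) =>
      apply: rat_computable_nuQpos; computability
  | |- rat_computable_on _ (fun o a => (_ + _)%R) => apply: rat_computable_add; computability
  | |- rat_computable_on _ (fun o a => (- _)%R) => apply: rat_computable_opp; computability
  | |- rat_computable_on _ (fun o a => (_ ^- _)%R) =>
      apply: rat_computable_expVn; computability
  | |- computable_on _ (fun o a => a) => exact: computable_id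
  | |- computable_on _ (fun o a => _.+1) => apply: computable_succ; computability
  | |- computable_on _ (fun o a => _.-1) => apply: computable_pred; computability
  | |- computable_on _ (fun o a => _ + _) => apply: computable_add; computability
  | |- computable_on _ (fun o a => _.*2) => apply: computable_double; computability
  | |- computable_on _ (fun o a => npair _ _) => apply: computable_npair; computability
  | |- computable_on _ (fun o a => proj1n _) => apply: computable_proj1n; computability
  | |- computable_on _ (fun o a => proj2n _) => apply: computable_proj2n; computability
  | |- computable_on _ (fun o a => nth 0 (CodeSeq.decode _) _) =>
      apply: computable_nth; computability
  | |- computable_on _ (fun o a => size (CodeSeq.decode _)) =>
      apply: computable_size; computability
  | |- computable_on _ (fun o a => wcode (nseq _ _)) =>
      apply: computable_code_nseq; computability
  | |- computable_on _ (fun o a => if _ then _ else _) => apply: computable_if; computability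
  | H : computable_on ?D ?h |- computable_on ?D (fun o a => ?h o _) =>
      apply: (computable_comp H); computability
  | H : computable_on ?D ?h |- computable_on ?D ?h => exact: H
  | H : computable_seq ?p |- computable_on _ (fun o a => ?p _) =>
      apply: (computable_seq_comp H); computability
  | |- computable_on _ (fun o a => o _) => apply: computable_oracle; computability
  | _ => try exact: computable_const
  end.

(** Bounded search in the output format of an associate: 0 for no answer yet, a successor for an
    answer. *)
Lemma nat_rect_last (T : nat -> bool) (v : nat -> nat) m :
  let r := nat_rect (fun=> nat) 0 (fun z c => if T z then (v z).+1 else c) m in
  (r = 0 -> forall z, z < m -> ~~ T z) /\
  (0 < r -> exists z, [/\ z < m, T z & r = (v z).+1]).
Proof.
elim: m => [|m [IH0 IHS]] /=; first by split.
case E : (T m); split=> //.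
- by move=> _; exists m.
- by move=> /IH0 H z; rewrite ltnS leq_eqVlt => /orP[/eqP->|/H//]; rewrite E.
- by move=> /IHS[z [zm Tz ->]]; exists z; split=> //; rewrite ltnS ltnW.
Qed.

(* At argument [n] and a prefix of [q], the associate looks for a witness of
   [S o n i (q i) v] below the length of the prefix. *)
Lemma computable_associate D (S : baire -> nat -> nat -> nat -> nat -> Prop) :
  semidecidable_on D (fun o t => S o (proj1n (proj1n t)) (proj2n (proj1n t))
    (proj1n (proj2n t)) (proj2n (proj2n t))) ->
  exists2 F, computable_on D F & forall o, D o -> forall q,
    (forall n, exists i v, S o n i (q i) v) ->
    exists2 r, eta (F o) q r & forall n, exists i, S o n i (q i) (r n).
Proof.
move=> [b cb bP].
have {}bP o n i a v : D o ->
    S o n i a v <-> exists k, b o (npair (npair n i) (npair a v)) k.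
  by move=> Do; have := bP o (npair (npair n i) (npair a v)) Do; rewrite !npairE.
(* A candidate [z] codes a position in the prefix, a proposed value and a stage confirming it. *)
pose T o t z := (proj1n z < size (CodeSeq.decode (proj2n t))) &&
  b o (npair (npair (proj1n t) (proj1n z))
       (npair (nth 0 (CodeSeq.decode (proj2n t)) (proj1n z)) (proj1n (proj2n z))))
    (proj2n (proj2n z)).
pose v z := proj1n (proj2n z).
pose F o t := nat_rect (fun=> nat) 0 (fun z c => if T o t z then (v z).+1 else c)
  (size (CodeSeq.decode (proj2n t))).
exists F.
  apply: (@computable_iter D (fun o t z c => if T o t z then (v z).+1 else c)
    (fun o t => size (CodeSeq.decode (proj2n t))) (fun _ _ => 0)); rewrite /v; computability.
  rewrite /T; apply: decidable_and; computability.
  suff cb' : forall f g, computable_on D f -> computable_on D g ->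
      decidable_on D (fun o t => b o (f o t) (g o t)) by apply: cb'; computability.
  move=> f g cf cg; have := computable_comp cb (computable_npair cf cg).
  by apply: computable_ext => o a _; rewrite !npairE.
move=> o Do q qS.
have TP n m z : T o (npair n (wcode (mkseq q m))) z =
    (proj1n z < m) && b o (npair (npair n (proj1n z)) (npair (q (proj1n z)) (v z)))
                         (proj2n (proj2n z)).
  rewrite /T /wcode !npairE CodeSeq.codeK size_mkseq.
  by case: ltnP => // zm; rewrite nth_mkseq.
have FP n m : let r := F o (npair n (wcode (mkseq q m))) in
    (r = 0 -> forall z, z < m -> ~~ T o (npair n (wcode (mkseq q m))) z) /\
    (0 < r -> exists z, [/\ z < m, T o (npair n (wcode (mkseq q m))) z & r = (v z).+1]).
  rewrite /F; have -> : size (CodeSeq.decode (proj2n (npair n (wcode (mkseq q m))))) = m.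
    by rewrite /wcode !npairE CodeSeq.codeK size_mkseq.
  exact: nat_rect_last.
have ex n : exists m, 0 < F o (npair n (wcode (mkseq q m))).
  have [i [w /bP-/(_ Do)[k bk]]] := qS n; pose z := npair i (npair w k).
  (* The prefix must contain position [i], and its length must also exceed [z], since it bounds the
     search. *)
  exists (maxn i z).+1; rewrite lt0n; apply/eqP => /(FP _ _).1 /(_ z).
  rewrite ltnS leq_maxr => /(_ isT); rewrite TP /v /z !npairE bk.
  by rewrite ltnS leq_maxl.
pose m n := ex_minn (ex n).
exists (fun n => (F o (npair n (wcode (mkseq q (m n))))).-1) => n.
  rewrite /m; case: ex_minnP => k k0 kmin; exists k; split; last by rewrite prednK.
  by move=> j jk; apply/eqP; rewrite eqn0Ngt; apply: contraL jk => /kmin; rewrite -leqNgt.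
rewrite /m; case: ex_minnP => k k0 _.
have [z [_ + ->]] := (FP n k).2 k0; rewrite TP => /andP[_ bz] /=.
by exists (proj1n z); apply/bP => //; exists (proj2n (proj2n z)).
Qed.

(** * Semi-decidable tests on names of points and of closed sets *)

Section Approximation.
Local Open Scope ring_scope.
Variables (R : realType) (X : metricType R) (nu : nat -> X).

Lemma semidecidable_mdist_lt D g : computable_seq g ->
  (forall i j k, `|mdist (nu i) (nu j) - ratr (nuQ (g (npair (npair i j) k)))|
     <= 2%:R ^- k :> R) ->
  forall a b q, computable_on D a -> computable_on D b -> rat_computable_on D q ->
  semidecidable_on D (fun o t => mdist (nu (a o t)) (nu (b o t)) < ratr (q o t) :> R).
Proof.
move=> cg gP a b q ca cb [qa [qb [qc [cqa cqb cqc qE]]]].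
suff : semidecidable_on D (fun o t => exists k,
    nuQ (g (npair (npair (a o t) (b o t)) k)) + 2%:R ^- k < q o t).
  apply: semidecidable_ext => o t Do; have ratrE k : ratr (2%:R ^- k) = 2%:R ^- k :> R.
    by rewrite fmorphV rmorphXn /= ratr_nat.
  split=> [[k]|dq].
    rewrite -(ltr_rat R) rmorphD /= ratrE.
    by have := gP (a o t) (b o t) k; rewrite ler_norml => /andP[_]; lra.
  (* Half of the gap, because the error [2 ^- k] enters twice: in the approximation and in the
     safety margin of the test. *)
  have [k kP] := @ex_expVn_lt R ((ratr (q o t) - mdist (nu (a o t)) (nu (b o t))) / 2)
    ltac:(rewrite divr_gt0// subr_gt0//).
  exists k; rewrite -(ltr_rat R) rmorphD /= ratrE.
  by have := gP (a o t) (b o t) k; rewrite ler_norml => /andP[+ _]; lra.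
computability.
exists (fun o t => qa o (proj1n t)), (fun o t => qb o (proj1n t)), (fun o t => qc o (proj1n t)).
by split=> [| | |o t /qE->//]; computability.
Qed.


(** A finite certificate: a point whose name has entry [a] at position [i] is within [2 ^- i] of
    [nu a], hence in one of the balls of [w]. *)
Definition inside (a i : nat) (w : seq nat) := exists l, (l < size w)%N /\
  mdist (center nu (nth 0%N w l)) (nu a) < radius R (nth 0%N w l) - 2%:R ^- i.

Lemma cauchy_naming_le p x l : cauchy_naming nu p x -> mdist (nu (p l)) x <= 2%:R ^- l.
Proof.
move=> [/cvg_ballP px pp]; apply/ler_addgt0Pr => e e0.
have [N _ NP] := px e e0; have := NP (maxn N l) (leq_maxl _ _) => /in_ball.
have := pp l (maxn N l); rewrite (minn_idPl (leq_maxr _ _)) /=.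
have := metric_triangle (nu (p l)) (nu (p (maxn N l))) x.
by rewrite (metric_sym x); lra.
Qed.

(** The extra factor 1/2 pays for the triangle inequality through [x]. *)
Lemma cauchy_namingW r x : (forall n, mdist (nu (r n)) x < 2%:R ^- n.+1) ->
  cauchy_naming nu r x.
Proof.
move=> rx; split.
  apply/cvg_ballP => e e0; have [N Ne] := ex_expVn_lt e0.
  exists N => // n /= Nn; apply/in_ball; rewrite metric_sym; apply: lt_trans (rx n) _.
  by apply: le_lt_trans Ne; apply: le_expVn; rewrite ltnW.
move=> i j; have := metric_triangle (nu (r i)) x (nu (r j)); rewrite (metric_sym x).
have := rx i; have := rx j.
have := @le_expVn R (minn i j).+1 i.+1; rewrite ltnS geq_minl => /(_ isT).
have := @le_expVn R (minn i j).+1 j.+1; rewrite ltnS geq_minr => /(_ isT).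
by rewrite (expVnS R (minn i j)); lra.
Qed.

Lemma cauchy_naming_cst a : cauchy_naming nu (fun=> a) (nu a).
Proof. by apply: cauchy_namingW => n; rewrite mdistxx expVn_gt0. Qed.

Lemma inside_word_open p x l w : cauchy_naming nu p x ->
  inside (p l) l w -> word_open nu w x.
Proof.
move=> px [i [iw ip]]; apply/word_openP; exists i => //.
have := cauchy_naming_le l px.
by have := metric_triangle (center nu (nth 0%N w i)) (nu (p l)) x; lra.
Qed.

(** The certificate exists at all late positions, so that a single position can serve finitely many
    cells. *)
Lemma word_open_inside p x w : cauchy_naming nu p x -> word_open nu w x ->
  exists L, forall l, (L <= l)%N -> inside (p l) l w.
Proof.
move=> px /word_openP[i iw ix].
have [L LP] := @ex_expVn_lt R
  ((radius R (nth 0%N w i) - mdist (center nu (nth 0%N w i)) x) / 2)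
  ltac:(rewrite divr_gt0// subr_gt0//).
exists L => l Ll; exists i; split=> //; have := cauchy_naming_le l px.
have := metric_triangle (center nu (nth 0%N w i)) x (nu (p l)).
by have := @le_expVn R _ _ Ll; rewrite (metric_sym x); lra.
Qed.

(* [missed p b]: the distance name in [p], evaluated on the constant name of
   the center of the ball [b], enumerates a rational above the radius of [b]. *)
Definition missed (p : baire) (b : nat) := exists n i m : nat,
  nuQpos (proj2n b) <= nuQ n /\
  ((forall j, (j < m)%N -> bsnd p (npair i (wcode (nseq j (proj1n b)))) = 0%N) /\
   bsnd p (npair i (wcode (nseq m (proj1n b)))) = n.+2).

Lemma mkseq_cst (a n : nat) : mkseq (fun=> a) n = nseq n a.
Proof.
by apply: (@eq_from_nth _ 0%N) => [|i]; rewrite size_mkseq ?size_nseq// => ni;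
  rewrite nth_mkseq// nth_nseq ni.
Qed.

(** Any finite computation found by search must therefore agree with the output that the realiser is
    known to have. *)
Lemma eta_unique p q r n m k : eta p q r ->
  (forall j, (j < m)%N -> p (npair n (wcode (mkseq q j))) = 0%N) ->
  p (npair n (wcode (mkseq q m))) = k.+1 -> r n = k.
Proof.
move=> /(_ n)[m' [m'0 m'r]] m0 mk; suff E : m' = m by move: mk; rewrite -E m'r => -[].
apply/eqP; rewrite eqn_leq; apply/andP; split; rewrite leqNgt; apply/negP.
  by move=> /m'0; rewrite mk.
by move=> /m0; rewrite m'r.
Qed.

Lemma dist_naming_lower p A a : dist_naming nu p A ->
  exists2 r, eta p (fun=> a) r & forall n,
    ((ratr (nuQ n))%:E < set_dist A (nu a))%E <-> exists i, r i = n.+1.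
Proof.
move=> [_ /(_ _ _ (cauchy_naming_cst a) I)[r pr [y rP yE]]]; exists r => // n.
by have /seteqP[/(_ n) ? /(_ n) ?] := rP; rewrite -yE.
Qed.

Lemma missed_le p A b : dist_naming nu (bsnd p) A -> missed p b ->
  ((radius R b)%:E <= set_dist A (center nu b))%E.
Proof.
move=> /(@dist_naming_lower _ _ (proj1n b))[r pr rP] [n [i [m [bn [m0 mn]]]]].
apply: (@le_trans _ _ (ratr (nuQ n))%:E); first by rewrite lee_fin ler_rat.
apply/ltW/rP; exists i; apply: eta_unique pr _ _.
  by move=> j /m0; rewrite mkseq_cst; apply.
by rewrite mkseq_cst.
Qed.

Lemma lt_missed p A b : dist_naming nu (bsnd p) A ->
  ((radius R b)%:E < set_dist A (center nu b))%E -> missed p b.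
Proof.
move=> /(@dist_naming_lower _ _ (proj1n b))[r pr rP] bA.
(* The radius itself, coded as a rational: being strictly below the distance, it is enumerated. *)
pose n := npair (npair (proj1n (proj2n b)).+1 0) (proj2n (proj2n b)).
have nE : nuQ n = nuQpos (proj2n b) by rewrite /nuQ /nuQpos !npairE subr0.
have [i ri] : exists i, r i = n.+1 by apply/rP; rewrite nE.
(* Of the two successors in [n.+2], one comes from the enumeration of rationals and one from the
   associate. *)
have [m [m0 mr]] := pr i; exists n, i, m; split; first by rewrite nE.
by split=> [j /m0|]; rewrite -mkseq_cst// mr ri.
Qed.

Definition range_approx (p : baire) (i l : nat) : nat := (bnth (bfst p) i l).-1.

Definition meets (p : baire) (w : seq nat) (i : nat) :=
  exists l, inside (range_approx p i l) l w.

Section Selection.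
Variables (D : set baire) (g P : nat -> nat).
Hypotheses (g_comp : computable_seq g) (P_comp : computable_seq P).
Hypothesis g_dist : forall i j k,
  `|mdist (nu i) (nu j) - ratr (nuQ (g (npair (npair i j) k)))| <= 2%:R ^- k :> R.

Lemma semidecidable_inside a i c :
  computable_on D a -> computable_on D i -> computable_on D c ->
  semidecidable_on D (fun o t => inside (a o t) (i o t) (CodeSeq.decode (c o t))).
Proof.
move=> ca ci cc; apply: (@semidecidable_ext D (fun o t => exists l,
    (l < size (CodeSeq.decode (c o t)))%N /\
    mdist (nu (proj1n (nth 0%N (CodeSeq.decode (c o t)) l))) (nu (a o t)) <
    ratr (nuQpos (proj2n (nth 0%N (CodeSeq.decode (c o t)) l)) - 2%:R ^- i o t) :> R)).
  move=> o t _; rewrite /inside.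
  have E l : ratr (nuQpos (proj2n (nth 0%N (CodeSeq.decode (c o t)) l)) - 2%:R ^- i o t) =
      radius R (nth 0%N (CodeSeq.decode (c o t)) l) - 2%:R ^- i o t.
    by rewrite rmorphB fmorphV rmorphXn /= ratr_nat.
  by split=> -[l [lc lP]]; exists l; split=> //; move: lP; rewrite E.
computability; apply: (semidecidable_mdist_lt g_comp g_dist); computability.
Qed.

Lemma semidecidable_small_word k c : computable_on D k -> computable_on D c ->
  semidecidable_on D (fun o t => small_word nu (k o t) (CodeSeq.decode (c o t))).
Proof.
move=> ck cc; apply: (@semidecidable_ext D (fun o t =>
    forall i, (i < size (CodeSeq.decode (c o t)))%N ->
    forall j, (j < size (CodeSeq.decode (c o t)))%N ->
    mdist (nu (proj1n (nth 0%N (CodeSeq.decode (c o t)) i)))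
          (nu (proj1n (nth 0%N (CodeSeq.decode (c o t)) j))) <
    ratr (2%:R ^- k o t - nuQpos (proj2n (nth 0%N (CodeSeq.decode (c o t)) i))
           - nuQpos (proj2n (nth 0%N (CodeSeq.decode (c o t)) j))) :> R)).
  move=> o t _; rewrite /small_word.
  have E i j : ratr (2%:R ^- k o t - nuQpos (proj2n (nth 0%N (CodeSeq.decode (c o t)) i))
           - nuQpos (proj2n (nth 0%N (CodeSeq.decode (c o t)) j))) =
      2%:R ^- k o t - radius R (nth 0%N (CodeSeq.decode (c o t)) i)
        - radius R (nth 0%N (CodeSeq.decode (c o t)) j).
    by rewrite !rmorphB fmorphV rmorphXn /= ratr_nat.
  by split=> H i => [j ic jc|ic j jc]; have := H i; [move=> /(_ ic j jc)|move=> /(_ j ic jc)];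
    rewrite E.
computability; apply: (semidecidable_mdist_lt g_comp g_dist); computability.
Qed.

Lemma semidecidable_missed b : computable_on D b ->
  semidecidable_on D (fun o t => missed o (b o t)).
Proof. by move=> cb; rewrite /missed /bsnd; computability. Qed.

Lemma computable_range_approx i l : computable_on D i -> computable_on D l ->
  computable_on D (fun o t => range_approx o (i o t) (l o t)).
Proof. by move=> ci cl; rewrite /range_approx /bnth /bfst; computability. Qed.

Lemma semidecidable_meets c i : computable_on D c -> computable_on D i ->
  semidecidable_on D (fun o t => meets o (CodeSeq.decode (c o t)) (i o t)).
Proof.
move=> cc ci; rewrite /meets; computability; apply: semidecidable_inside; computability.
by apply: computable_range_approx; computability.
Qed.

(** Disjointness and covering are not tested: [P] lists only disjoint covers. What remains is
    semi-decidable in the name [o]. *)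
Definition decided_cover (o : baire) (k c : nat) := (exists i, P i = c.+1) /\
  forall j, (j < size (CodeSeq.decode c))%N ->
    small_word nu k (CodeSeq.decode (nth 0%N (CodeSeq.decode c) j)) /\
    ((forall l, (l < size (CodeSeq.decode (nth 0%N (CodeSeq.decode c) j)))%N ->
       missed o (nth 0%N (CodeSeq.decode (nth 0%N (CodeSeq.decode c) j)) l)) \/
     exists i, meets o (CodeSeq.decode (nth 0%N (CodeSeq.decode c) j)) i).

(** The value 0 records that the cell misses [A], and [i.+1] that the [i]-th point of the range name
    lies in it. The first alternative lets the search halt on indices outside the cover. *)
Definition hit (o : baire) (c j v : nat) := ((size (CodeSeq.decode c) <= j)%N /\ v = 0%N) \/
  (v = 0%N /\ (forall l, (l < size (CodeSeq.decode (nth 0%N (CodeSeq.decode c) j)))%N ->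
       missed o (nth 0%N (CodeSeq.decode (nth 0%N (CodeSeq.decode c) j)) l))) \/
  exists i, v = i.+1 /\ meets o (CodeSeq.decode (nth 0%N (CodeSeq.decode c) j)) i.

Lemma computable_selection : (forall o k, D o -> exists c, decided_cover o k c) ->
  exists cov h : baire -> nat -> nat, [/\ computable_on D cov, computable_on D h,
    forall o k, D o -> decided_cover o k (cov o k)
  & forall o k j, D o -> hit o (cov o k) j (h o (npair k j))].
Proof.
move=> ex; have [|cov ccov covP] := @semidecidable_choice D decided_cover _ ex.
  rewrite /decided_cover; computability.
  - by apply: semidecidable_small_word; computability.
  - by apply: semidecidable_missed; computability.
  - by apply: semidecidable_meets; computability.
have [||h ch hP] := @semidecidable_choice D
    (fun o t v => hit o (cov o (proj1n t)) (proj2n t) v).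
- rewrite /hit; computability.
  - by apply: semidecidable_missed; computability.
  - by apply: semidecidable_meets; computability.
- move=> o t Do; have [sz|sz] := leqP (size (CodeSeq.decode (cov o (proj1n t)))) (proj2n t).
    by exists 0%N; left.
  have [_ /(_ _ sz)[_ [H|[i H]]]] := covP o (proj1n t) Do.
    by exists 0%N; right; left.
  by exists i.+1; right; right; exists i.
exists cov, h; split=> // o k j Do.
by have := hP o (npair k j) Do; rewrite !npairE.
Qed.

(* [v] approximates the retract of every point within [2 ^- i] of [nu a]. *)
Definition retract_step (cov h : baire -> nat -> nat) (o : baire) (n i a v : nat) :=
  exists c K : nat,
  (forall k, (k < n + 4)%N ->
     (nth 0%N (CodeSeq.decode c) k < size (CodeSeq.decode (cov o k)))%N /\
     inside a i (CodeSeq.decode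
       (nth 0%N (CodeSeq.decode (cov o k)) (nth 0%N (CodeSeq.decode c) k)))) /\
  (stopped (fun k j => h o (npair k j)) (fun k => nth 0%N (CodeSeq.decode c) k) (n + 4) K /\
   v = range_approx o (selected (fun k j => h o (npair k j))
                                (fun k => nth 0%N (CodeSeq.decode c) k) K) (n + 3)).

Lemma semidecidable_retract_step cov h : computable_on D cov -> computable_on D h ->
  semidecidable_on D (fun o t => retract_step cov h o (proj1n (proj1n t)) (proj2n (proj1n t))
    (proj1n (proj2n t)) (proj2n (proj2n t))).
Proof.
move=> ccov ch; rewrite /retract_step; computability.
- by apply: semidecidable_inside; computability.
- apply: (@semidecidable_ext D (fun o t => (proj2n t <= proj1n (proj1n (proj1n (proj1n t))) + 4)%N /\
    ((forall j, (j < proj2n t)%N ->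
       (0 < h o (npair j (nth 0%N (CodeSeq.decode (proj2n (proj1n t))) j)))%N) /\
    (proj2n t = (proj1n (proj1n (proj1n (proj1n t))) + 4)%N \/
     h o (npair (proj2n t) (nth 0%N (CodeSeq.decode (proj2n (proj1n t))) (proj2n t))) = 0%N)))).
    by move=> o t _; split=> [[? [? ?]]|[? ? ?]].
  by computability.
- apply: computable_range_approx; last by computability.
  apply: (@computable_selected D (fun o k j => h o (npair k j))
    (fun o t k => nth 0%N (CodeSeq.decode (proj2n (proj1n t))) k)); computability.
Qed.

End Selection.

End Approximation.

(** * Well-definedness of the operation and correctness of its realiser *)

Section Main.
Local Open Scope ring_scope.
Variables (R : realType) (X : metricType R) (nu : nat -> X).
Hypotheses (nu_dense : dense (range nu)) (X_compact : compact [set: X])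
  (X_dim : covering_dim_le [set: X] 0).

Lemma retraction_exists (A : set X) : closed A -> A !=set0 -> retractions_onto A !=set0.
Proof.
move=> cA [a Aa].
have /choice[ws wsP] : forall k, exists ws, _ := fun k =>
  ex_decided_cover nu_dense X_compact A k X_dim.
(* Without a name of [A], a point is chosen for every cell, indexed by level and cell; [a] is the
   default for cells that miss [A]. *)
have /choice[y yP] : forall t, exists y, A y /\
    ((exists2 z, A z & word_open nu (nth [::] (ws (proj1n t)) (proj2n t)) z) ->
     word_open nu (nth [::] (ws (proj1n t)) (proj2n t)) y).
  move=> t; have [[z Az wz]|H] := pselect (exists2 z, A z &
    word_open nu (nth [::] (ws (proj1n t)) (proj2n t)) z); first by exists z.
  by exists a.
pose h k j := if `[< exists2 z, A z & word_open nu (nth [::] (ws k) j) z >]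
  then (npair k j).+1 else 0%N.
have [f fA _] := @ex_retraction R X nu A ws h y cA
  (fun i => (yP i).1) (fun k => let: And4 H _ _ _ := wsP k in H)
  (fun k => let: And4 _ H _ _ := wsP k in H) (fun k => let: And4 _ _ H _ := wsP k in H)
  ltac:(move=> k j z _; rewrite /h; case: asboolP => // H _ Az wz; apply: H; exists z => //)
  ltac:(move=> k j i _; rewrite /h; case: asboolP => // H [<-];
    have := (yP (npair k j)).2; rewrite !npairE; apply=> //).
by exists f.
Qed.

Section Effective.
Variables (g P : nat -> nat).
Hypotheses (g_comp : computable_seq g) (P_comp : computable_seq P).
Hypothesis g_dist : forall i j k,
  `|mdist (nu i) (nu j) - ratr (nuQ (g (npair (npair i j) k)))| <= 2%:R ^- k :> R.
Hypothesis P_cover : [set a | exists i, P i = a.+1] = disj_cover_codes nu [set: X].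

Let D : set baire := [set p | exists A, [/\ range_naming nu (bfst p) A,
  dist_naming nu (bsnd p) A & A !=set0]].

Lemma range_naming_points p A : A !=set0 -> range_naming nu p A ->
  exists x : nat -> X, [/\ forall i, cauchy_naming nu (fun j => (bnth p i j).-1) (x i),
    forall i, A (x i) & A `<=` closure (range x)].
Proof. by move=> [a Aa] [_ [[A0]|[_ _]//]]; rewrite A0 in Aa. Qed.

Lemma nth_map_decode c j :
  nth [::] (map CodeSeq.decode (CodeSeq.decode c)) j =
  CodeSeq.decode (nth 0%N (CodeSeq.decode c) j).
Proof.
have [jc|jc] := ltnP j (size (CodeSeq.decode c)); first by rewrite (nth_map 0%N).
by rewrite !nth_default ?size_map.
Qed.

Lemma decode_wcode_map ws : map CodeSeq.decode (CodeSeq.decode (wcode (map wcode ws))) = ws.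
Proof. by rewrite /wcode CodeSeq.codeK (mapK CodeSeq.codeK). Qed.

(** This uses the completeness of the list [P]: since every disjoint cover occurs in it, so does the
    decided one. *)
Lemma ex_decided_cover_code p k : D p -> exists c, decided_cover nu P p k c.
Proof.
move=> [A [/range_naming_points rA dA A0]]; have [x [px Ax Ax']] := rA A0.
have [ws [wsd wsc wss wsA]] := ex_decided_cover nu_dense X_compact A k X_dim.
exists (wcode (map wcode ws)); split.
  suff : [set a | exists i, P i = a.+1] (wcode (map wcode ws)) by [].
  by rewrite P_cover; exists ws.
move=> j jc; rewrite -nth_map_decode decode_wcode_map.
have jws : nth [::] ws j \in ws.
  by apply: mem_nth; rewrite -[ws in size ws]decode_wcode_map size_map.
split; first exact: wss.
have [H|[y Ay wy]] := wsA _ jws; first by left=> l /H; exact: lt_missed.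
(* By density, an open cell that meets [A] contains one of the listed points. *)
have [|_ [[i _ <-] wz]] := Ax' y Ay (word_open nu (nth [::] ws j)).
  exact: open_nbhs_nbhs (conj (@open_word_open _ _ _ _) wy).
right; exists i; have [L LP] := word_open_inside (px i) wz.
by exists L; exact: LP.
Qed.

Lemma computable_retraction : computable_op
  (meet_naming (range_naming nu) (dist_naming nu))
  (fun_naming (cauchy_naming nu) (cauchy_naming nu))
  [set A : set X | closed A /\ A !=set0] (@retractions_onto R X).
Proof.
have [cov [h [ccov ch covP hP]]] := @computable_selection _ _ nu D g P g_comp P_comp g_dist
  ex_decided_cover_code.
have [F [e eF] FP] := computable_associate
  (semidecidable_retract_step g_comp g_dist ccov ch).
exists e => p A [rA dA] [cA A0].
have Dp : D p by exists A.
exists (F p) => [n|]; first exact: eF.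
have [x [px Ax _]] := range_naming_points A0 rA.
pose ws k := map CodeSeq.decode (CodeSeq.decode (cov p k)).
have szws k : size (ws k) = size (CodeSeq.decode (cov p k)) by rewrite size_map.
have wsP k : [/\ forall i j, (i < size (ws k))%N -> (j < size (ws k))%N -> i <> j ->
      formally_disjoint nu (nth [::] (ws k) i) (nth [::] (ws k) j),
    [set: X] `<=` \bigcup_(w in [set` ws k]) word_open nu w &
    forall w, w \in ws k -> small_word nu k w].
  have [[i Pi] cs] := covP p k Dp.
  have : disj_cover_codes nu [set: X] (cov p k) by rewrite -P_cover; exists i.
  move=> [ws' [cE wsd wsc]]; have wsE : ws k = ws' by rewrite /ws cE decode_wcode_map.
  split; rewrite ?wsE// => w /(nthP [::])[j]; rewrite -wsE => jw <-.
  by rewrite nth_map_decode; apply: (cs j _).1; rewrite -szws.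
have [||f fA fP] := @ex_retraction R X nu A ws (fun k j => h p (npair k j)) x cA Ax
  (fun k => let: And3 H _ _ := wsP k in H) (fun k => let: And3 _ H _ := wsP k in H)
  (fun k => let: And3 _ _ H := wsP k in H).
- move=> k j z jk h0 Az; case: (hP p k j Dp) => [[]|[[_ H]|[i []]]].
  + by rewrite -szws leqNgt jk.
  + by apply: missed_word Az => l; rewrite nth_map_decode => /H; exact: missed_le.
  + by rewrite h0.
- move=> k j i jk hi; case: (hP p k j Dp) => [[]|[[]|[i' []]]]; rewrite hi//.
  by move=> [<-] [l il]; rewrite nth_map_decode; exact: inside_word_open (px i) il.
(* The map [f] is fixed before [q], so all names of [z] lead to approximations of the same point. *)
exists f => // q z qz _.
have cells k : exists j, (j < size (ws k))%N /\ word_open nu (nth [::] (ws k) j) z.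
  have [_ wsc _] := wsP k; have [w /= wk wz] := wsc z I.
  by exists (index w (ws k)); rewrite index_mem nth_index.
have /choice[s sP] := cells.
have [n|r Fr rP] := FP p Dp q.
  (* The true cells [s] of [z] only show that the search succeeds; the estimate for [f] holds for
     whichever cells it finds. *)
  have [L LP] : exists L, forall k, (k < n + 4)%N ->
      forall l, (L <= l)%N -> inside nu (q l) l (nth [::] (ws k) (s k)).
    elim: (n + 4)%N => [|N [L LP]]; first by exists 0%N.
    have [L' L'P] := word_open_inside qz (sP N).2.
    exists (maxn L L') => k; rewrite ltnS leq_eqVlt => /orP[/eqP->|kN] l; rewrite geq_max.
      by move=> /andP[_]; exact: L'P.
    by move=> /andP[Ll _]; exact: LP.
  pose c := CodeSeq.code (mkseq s (n + 4)).
  have cE k : (k < n + 4)%N -> nth 0%N (CodeSeq.decode c) k = s k.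
    by move=> kn; rewrite /c CodeSeq.codeK nth_mkseq.
  have [K KP] := ex_stopped (fun k j => h p (npair k j))
    (fun k => nth 0%N (CodeSeq.decode c) k) (n + 4).
  exists L; eexists; exists c, K; split; last by split; [exact: KP|reflexivity].
  move=> k kn; rewrite cE// -szws -nth_map_decode; split; first exact: (sP k).1.
  exact: LP.
(* Levels 0 to [n + 3] give an error of [2 * 2 ^- (n + 3)], and reading the selected point at
   position [n + 3] adds [2 ^- (n + 3)]. The sum is three quarters of the permitted [2 ^- n.+1]. *)
exists r => //; exists (f z) => //; apply: cauchy_namingW => n.
have [i [c [K [cP [KP ->]]]]] := rP n.
have := fP (n + 3)%N z (fun k => nth 0%N (CodeSeq.decode c) k) K.
have n34 : (n + 3).+1 = (n + 4)%N by lia.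
rewrite n34 => /(_ _ KP) near_f; set y := selected _ _ _ in near_f *.
have {near_f} : mdist (x y) (f z) <= 2%:R ^- (n + 3) + 2%:R ^- (n + 3).
  apply: near_f => k kn; have [|jc ic] := cP k; first by rewrite -n34.
  by rewrite szws nth_map_decode; split=> //; exact: inside_word_open qz ic.
have := cauchy_naming_le (n + 3) (px y); have := expVn_gt0 R (n + 3).
have := metric_triangle (nu (range_approx p y (n + 3))) (x y) (f z).
by rewrite /range_approx (expVnS R n.+1) (expVnS R n.+2) (addn3 n); lra.
Qed.

End Effective.
End Main.

Theorem theorem7p6 (R : realType) (X : metricType R) (nu : nat -> X)
    (hX : computable_metric_space nu)
    (hcover : computable_point (disj_cover_naming nu) [set: X]) :
  (forall A : set X, closed A -> A !=set0 -> retractions_onto A !=set0) /\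
  computable_op
    (meet_naming (range_naming nu) (dist_naming nu))
    (fun_naming (cauchy_naming nu) (cauchy_naming nu))
    [set A : set X | closed A /\ A !=set0]
    (@retractions_onto R X).
Proof.
have [nu_dense [g g_comp g_dist]] := hX.
have [P P_comp [[X_compact X_dim] P_cover]] := hcover.
split; first exact: (retraction_exists nu_dense X_compact X_dim).
exact: (computable_retraction nu_dense X_compact X_dim g_comp P_comp g_dist P_cover).
Qed.
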